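(* For $\mu\in cabv(X)$ define $$\|\mu\|_H=\inf\{\|\nu\|_{MK}^{*}+\|\mu-\nu\| \;:\; \nu\in cabv(X,0)\}.$$ 1. The functional $\|\cdot\|_H:cabv(X)\to\mathbb{R}_+$ is a norm on $cabv(X)$ which generates a topology weaker than the variational topology generated by $\|\cdot\|$: $\|\mu\|_H\le\|\mu\|$ for every $\mu\in cabv(X)$. 2. On $cabv(X,0)$, the modified Monge-Kantorovich norm $\|\cdot\|_{MK}^{*}$ and the restriction of $\|\cdot\|_H$ are equivalent: $$\|\mu\|_H\le\|\mu\|_{MK}^{*}\le\max(\operatorname{diam}(T),1)\,\|\mu\|_H$$ for every $\mu\in cabv(X,0)$ (hence $\|\mu\|_H=\|\mu\|_{MK}^{*}$ for every $\mu\in cabv(X,0)$ if $\operatorname{diam}(T)\le1$).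
   Context: $(T,d)$ is a compact metric space with at least two elements, with Borel $\sigma$-algebra $\mathcal{B}$; $\operatorname{diam}(T)=\sup\{d(x,y):x,y\in T\}$. $X$ is a nonzero Hilbert space over $K$ ($K=\mathbb{R}$ or $K=\mathbb{C}$), with scalar product $(\cdot\mid\cdot)$ (linear in the first variable, conjugate-linear in the second) and norm $\|\cdot\|$. $C(X)$ is the space of continuous functions $f:T\to X$ with the sup norm $\|f\|$. $cabv(X)$ is the vector space over $K$ of $\sigma$-additive measures $\mu:\mathcal{B}\to X$ of bounded variation, where the variation is $|\mu|(A)=\sup\sum_i\|\mu(A_i)\|$ over finite partitions $(A_i)$ of $A$ into Borel sets; $\|\mu\|=|\mu|(T)$ is the variational norm. $cabv(X,0)=\{\mu\in cabv(X):\mu(T)=0\}$. Integral: for a simple function $f=\sum_{i=1}^m\varphi_{A_i}x_i$ ($A_i\in\mathcal{B}$, $x_i\in X$, $\varphi_{A}$ the indicator function of $A$) put $\int f\,d\mu=\sum_{i=1}^m(x_i\mid\mu(A_i))\in K$; for $f\in C(X)$ put $\int f\,d\mu=\lim_n\int f_n\,d\mu$, where $(f_n)$ is any sequence of simple functions converging uniformly to $f$ (the limit exists and does not depend on the sequence; the integral is linear in $f$, conjugate-linear in $\mu$, and $|\int f\,d\mu|\le\|\mu\|\|f\|$). $L(X)$ is the space of Lipschitz functions $f:T\to X$, $\|f\|_L$ is the least Lipschitz constant of $f$, $L_1(X)=\{f\in L(X):\|f\|_L\le1\}$. The modified Monge-Kantorovich norm on $cabv(X,0)$ is $\|\mu\|_{MK}^{*}=\sup\{|\int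 f\,d\mu|: f\in L_1(X)\}$ (it is finite and a norm on $cabv(X,0)$). $\mathbb{R}_+=[0,\infty)$. *)

(* Defs.v *)
From HB Require Import structures.
From mathcomp Require Import all_boot all_order all_algebra complex.
From mathcomp Require Import all_classical all_reals all_analysis.

Set Implicit Arguments.
Unset Strict Implicit.
Unset Printing Implicit Defensive.

Import Order.TTheory GRing.Theory Num.Theory.
Import numFieldNormedType.Exports.

Local Open Scope classical_set_scope.
Local Open Scope ring_scope.

Variant scalar_kind := RealScalars | ComplexScalars.

(* The scalar field K, i.e. R or C = R[i]. *)
Definition scalar_field (R : realType) (k : scalar_kind) : numFieldType :=
  match k with RealScalars => R | ComplexScalars => R[i] end.

Definition scalar_conj (R : realType) (k : scalar_kind) :
    scalar_field R k -> scalar_field R k :=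
  match k with RealScalars => id | ComplexScalars => @conjc R end.

Definition scalar_re (R : realType) (k : scalar_kind) : scalar_field R k -> R :=
  match k with RealScalars => id | ComplexScalars => @complex.Re R end.

(* MathComp norms over K take their (real, nonnegative) values in K; [rnorm]
   is the same norm with values in R.  It applies to vectors and to scalars. *)
Definition rnorm (R : realType) (k : scalar_kind)
    (V : normedZmodType (scalar_field R k)) (v : V) : R := scalar_re `|v|.

Definition borel (T : topologicalType) : set (set T) := <<s @open T >>.

Definition diam (R : realType) (T : metricType R) : R :=
  sup [set mdist p.1 p.2 | p in [set: T * T]].

Section VectorMeasures.
Context (R : realType) (k : scalar_kind) (T : topologicalType)
  (X : normedModType (scalar_field R k)).
Implicit Types (mu : set T -> X) (A : set T).

(* The sums over the finite partitions of A into Borel sets (empty pieces are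
   allowed, they contribute nothing when mu is additive). *)
Definition variation_sums mu A : set R :=
  [set s | exists (n : nat) (P : nat -> set T),
    [/\ forall i, (i < n)%N -> borel (P i),
        trivIset `I_n P,
        \bigcup_(i in `I_n) P i = A &
        s = \sum_(i < n) rnorm (mu (P i))]].

Definition variation mu A : \bar R :=
  ereal_sup [set s%:E | s in variation_sums mu A].

Definition vsigma_additive mu :=
  forall F : nat -> set T, (forall i, borel (F i)) -> trivIset setT F ->
    (fun n => \sum_(0 <= i < n) mu (F i)) @ \oo --> mu (\bigcup_n F n).

(* A measure is a function on the Borel sets only; it is encoded as a function
   on all sets that vanishes off the Borel sets, so that two measures are equal
   as soon as they agree on the Borel sets. *)
Definition is_cabv mu : Prop :=
  [/\ forall A, ~ borel A -> mu A = 0,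
      vsigma_additive mu &
      (variation mu setT < +oo)%E].

Definition cabv_pred : {pred set T -> X} := fun mu => `[< is_cabv mu >].

Lemma rnorm_comb (a : scalar_field R k) (x y : X) :
  rnorm (a *: x + y) <= rnorm a * rnorm x + rnorm y.
Proof.
rewrite /rnorm.
have h : `|a *: x + y| <= `|a| * `|x| + `|y|.
  by rewrite -normrZ; exact: ler_normD.
have a0 : 0 <= `|a| by [].
have x0 : 0 <= `|x| by [].
move: h a0 x0; move: `|a *: x + y| `|a| `|x| `|y|.
case: (k) => //= -[p p'] [q q'] [r r'] [s s'].
rewrite !lecE /= => /andP[_ h] /andP[/eqP q'0 _] _.
by move: h; rewrite q'0 mul0r subr0.
Qed.

Lemma rnorm_ge0 (V : normedZmodType (scalar_field R k)) (v : V) : 0 <= rnorm v.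
Proof.
rewrite /rnorm; have : 0 <= `|v| by [].
move: `|v|; case: (k) => //= -[p p'].
by rewrite lecE /= => /andP[].
Qed.

Lemma cabv_pred_submod_closed : submod_closed cabv_pred.
Proof.
split.
  apply/asboolP; split => //.
  - move=> F _ _; rewrite (_ : (fun n : nat => _) = cst 0).
      exact: cvg_cst.
    by apply/funext => n; rewrite big1.
  - apply: (@le_lt_trans _ _ 0%:E); last exact: ltry.
    apply: ge_ereal_sup => _ [_ [n [P [_ _ _ ->]]] <-]; rewrite lee_fin big1//.
    move=> i _; rewrite /rnorm normr0; by case: (k).
move=> a mu nu /asboolP[mu0 mus muv] /asboolP[nu0 nus nuv].
apply/asboolP; split.
- by move=> A nA; rewrite /= !fctE mu0 // nu0 // scaler0 addr0.
- move=> F bF tF; rewrite (_ : (fun n : nat => _) =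
    (fun n => a *: (\sum_(0 <= i < n) mu (F i)) + \sum_(0 <= i < n) nu (F i))).
    by apply: cvgD; [apply: cvgZr; exact: mus | exact: nus].
  by apply/funext => n; rewrite scaler_sumr -big_split.
- have fin m : (variation m setT < +oo)%E ->
      exists M, forall s, variation_sums m setT s -> s <= M.
    move=> mfin; have ub s : variation_sums m setT s ->
        (s%:E <= variation m setT)%E.
      by move=> ms; apply: ereal_sup_ubound; exists s.
    move: mfin ub; case: (variation m setT) => [r _|//|_] ub.
      by exists r => s /ub; rewrite lee_fin.
    by exists 0 => s /ub; rewrite leeNy_eq.
  have [M hM] := fin _ muv; have [N hN] := fin _ nuv.
  apply: (@le_lt_trans _ _ (rnorm a * M + N)%:E); last exact: ltry.
  apply: ge_ereal_sup => _ [_ [n [P [bP tP cP ->]]] <-]; rewrite lee_fin.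
  apply: (@le_trans _ _ (rnorm a * (\sum_(i < n) rnorm (mu (P i))) +
    \sum_(i < n) rnorm (nu (P i)))).
    rewrite mulr_sumr -big_split; apply: ler_sum => i _; exact: rnorm_comb.
  apply: lerD; last by apply: hN; exists n, P.
  apply: ler_wpM2l; first exact: rnorm_ge0.
  by apply: hM; exists n, P.
Qed.

HB.instance Definition _ := GRing.isSubmodClosed.Build (scalar_field R k)
  (set T -> X) cabv_pred cabv_pred_submod_closed.

Record cabv := Cabv { cabv_val :> set T -> X; _ : cabv_val \in cabv_pred }.

HB.instance Definition _ := [isSub for cabv_val].
HB.instance Definition _ := [Choice of cabv by <:].
HB.instance Definition _ := [SubChoice_isSubLmodule of cabv by <:].

Definition cabv0 : set cabv := [set mu | mu setT = 0].

(* [fine] is harmless, as [variation mu setT] is finite. *)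
Definition var_norm (mu : cabv) : R := fine (variation mu setT).

End VectorMeasures.

Arguments cabv {R k} T X.
Arguments cabv0 {R k T X}.
Arguments var_norm {R k T X} mu.

Section MongeKantorovich.
Context (R : realType) (k : scalar_kind) (T : metricType R)
  (X : normedModType (scalar_field R k)) (dot : {dot X for @scalar_conj R k}).
Implicit Types (mu nu : cabv T X) (f : T -> X).

(* The list [:: (A_1, x_1); ...; (A_m, x_m)] represents the simple function
   \sum_i \1_(A_i) x_i. *)
Definition simple_eval (s : seq (set T * X)) : T -> X :=
  fun t => \sum_(p <- s) (\1_(p.1) t : scalar_field R k) *: p.2.

Definition simple_integral mu (s : seq (set T * X)) : scalar_field R k :=
  \sum_(p <- s) dot p.2 (mu p.1).

Definition is_integral mu f (l : scalar_field R k) : Prop :=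
  exists s : nat -> seq (set T * X),
    [/\ forall n p, p \in s n -> borel p.1,
        {uniform, (fun n => simple_eval (s n)) @ \oo --> f} &
        (fun n => simple_integral mu (s n)) @ \oo --> l].

(* For continuous f on a compact T there is exactly one such l. *)
Definition integral mu f : scalar_field R k := xget 0 (is_integral mu f).

Definition lipschitz_const (c : R) f :=
  0 <= c /\ forall s t, rnorm (f s - f t) <= c * mdist s t.

Definition lipschitz_functions : set (T -> X) :=
  [set f | exists c, lipschitz_const c f].

Definition lipschitz_seminorm f : R := inf [set c | lipschitz_const c f].

Definition L1 : set (T -> X) :=
  [set f | lipschitz_functions f /\ lipschitz_seminorm f <= 1].

(* Meaningful for mu in [cabv0], where the set of values is bounded. *)
Definition MK_norm mu : R := sup [set rnorm (integral mu f) | f in L1].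

Definition H_norm mu : R :=
  inf [set MK_norm nu + var_norm (mu - nu) | nu in cabv0].

End MongeKantorovich.

Section Norms.
Context (R : realType) (k : scalar_kind) (V : lmodType (scalar_field R k)).
Implicit Types (N : V -> R) (S U : set V).

Definition is_norm N : Prop :=
  [/\ forall v, 0 <= N v,
      forall v, N v = 0 -> v = 0,
      forall (a : scalar_field R k) v, N (a *: v) = rnorm a * N v &
      forall u v, N (u + v) <= N u + N v].

Definition norm_open N U : Prop :=
  forall u, U u -> exists2 r : R, 0 < r & forall v, N (v - u) < r -> U v.

(* The topology generated by N is coarser (not necessarily strictly) than the
   one generated by N'. *)
Definition weaker_topology N N' : Prop :=
  forall U, norm_open N U -> norm_open N' U.

Definition equivalent_on S N N' : Prop :=
  exists a b : R, [/\ 0 < a, 0 < b &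
    forall v, S v -> a * N v <= N' v <= b * N v].

End Norms.

(* Main.v *)
(** Everything is reduced to the Monge-Kantorovich norm on cabv0.  The integral
of a constant against a measure of total mass 0 vanishes, so f may be replaced
by f - f t0, which is bounded by diam T when f is in L1; hence
MK_norm <= diam T * var_norm on cabv0, and the triangle inequality for MK_norm
gives MK_norm mu <= max (diam T, 1) * (MK_norm nu + var_norm (mu - nu)).  Since
|mu T| = |(mu - nu) T| <= var_norm (mu - nu), a measure with H_norm mu = 0 lies
in cabv0 and satisfies MK_norm mu = 0.  Such a measure integrates every
Lipschitz function to 0; the tent functions max (0, 1 - dist (., F) / d) x,
decomposed along the level sets of dist (., F), show that it vanishes on every
closed set F, hence on all Borel sets by the pi-lambda theorem. *)

Require Import Defs.
From HB Require Import structures.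
From mathcomp Require Import all_boot all_order all_algebra complex.
From mathcomp Require Import all_classical all_reals all_analysis.
From mathcomp Require Import ring lra.
Set Implicit Arguments.
Unset Strict Implicit.
Unset Printing Implicit Defensive.
Import Order.TTheory GRing.Theory Num.Theory.
Import numFieldNormedType.Exports.
Local Open Scope classical_set_scope.
Local Open Scope ring_scope.

(** * Real-valued norms over R or C *)

(** The embedding of R in K. It preserves and reflects order, so inequalities between norms move
    from K to R, and the later sections need no case split on [k]. *)
Definition scalar_of_real (R : realType) (k : scalar_kind) :
    R -> scalar_field R k :=
  match k with RealScalars => id | ComplexScalars => @real_complex R end.
Arguments scalar_of_real {R k}.

Section RealValuedNorm.
Context (R : realType) (k : scalar_kind).
Local Notation K := (scalar_field R k).
Local Notation sc := (@scalar_of_real R k).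
Local Notation conj := (@scalar_conj R k).

Lemma scalar_of_real_le : {mono sc : a b / a <= b}.
Proof. by rewrite /sc /K; case: k => //= a b; rewrite lecR. Qed.

Lemma scalar_of_real_lt : {mono sc : a b / a < b}.
Proof. by rewrite /sc /K; case: k => //= a b; rewrite ltcR. Qed.

Lemma scalar_of_real_inj : injective sc.
Proof. by move=> a b ab; apply/le_anti;
  rewrite -!scalar_of_real_le ab lexx. Qed.

Lemma scalar_of_real0 : sc 0 = 0. Proof. by rewrite /sc /K; case: k. Qed.

Lemma scalar_of_real1 : sc 1 = 1. Proof. by rewrite /sc /K; case: k. Qed.

Lemma scalar_of_realD : {morph sc : a b / a + b}.
Proof. by rewrite /sc /K; case: k => //= a b; rewrite rmorphD. Qed.

Lemma scalar_of_realN : {morph sc : a / - a}.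
Proof. by rewrite /sc /K; case: k => //= a; rewrite rmorphN. Qed.

Lemma scalar_of_realB : {morph sc : a b / a - b}.
Proof. by move=> a b; rewrite scalar_of_realD scalar_of_realN. Qed.

Lemma scalar_of_realM : {morph sc : a b / a * b}.
Proof. by rewrite /sc /K; case: k => //= a b; rewrite rmorphM. Qed.

(** A nonnegative element of R[i] has zero imaginary part, so passing to the real part in [rnorm]
    loses nothing. *)
Lemma normr_rnorm (V : normedZmodType K) (v : V) : `|v| = sc (rnorm v).
Proof.
rewrite /rnorm; have : 0 <= `|v| by []; move: `|v|.
rewrite /sc /K; case: k => //= -[p p']; rewrite lecE /= => /andP[/eqP -> _].
by [].
Qed.

Lemma rnorm_scalar_of_real (a : R) : rnorm (sc a) = `|a|.
Proof.
by apply: scalar_of_real_inj; rewrite -normr_rnorm /sc /K; case: k => //=;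
  rewrite normc_def /= expr0n addr0 sqrtr_sqr.
Qed.

Section Zmod.
Context (V : normedZmodType K).
Implicit Types u v w : V.

Lemma rnorm0 : rnorm (0 : V) = 0.
Proof. by apply: scalar_of_real_inj;
  rewrite -normr_rnorm normr0 scalar_of_real0. Qed.

Lemma rnorm_eq0 v : rnorm v = 0 -> v = 0.
Proof. by move=> v0; apply/eqP;
  rewrite -normr_eq0 normr_rnorm v0 scalar_of_real0. Qed.

Lemma rnormD u v : rnorm (u + v) <= rnorm u + rnorm v.
Proof.
by rewrite -scalar_of_real_le scalar_of_realD -!normr_rnorm ler_normD.
Qed.

Lemma rnormN v : rnorm (- v) = rnorm v.
Proof. by rewrite /rnorm normrN. Qed.

Lemma rnormBC u v : rnorm (u - v) = rnorm (v - u).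
Proof. by rewrite -rnormN opprB. Qed.

Lemma rnorm_distD w u v : rnorm (u - v) <= rnorm (u - w) + rnorm (w - v).
Proof. by rewrite -(subrKA w) rnormD. Qed.

Lemma rnorm_sum (I : Type) (r : seq I) (P : pred I) (F : I -> V) :
  rnorm (\sum_(i <- r | P i) F i) <= \sum_(i <- r | P i) rnorm (F i).
Proof.
elim/big_rec2: _ => [|i x y _ le]; first by rewrite rnorm0.
by rewrite (le_trans (rnormD _ _))// lerD2l.
Qed.

End Zmod.

Lemma rnormM (a b : K) : rnorm (a * b) = rnorm a * rnorm b.
Proof.
by apply: scalar_of_real_inj; rewrite scalar_of_realM -!normr_rnorm normrM.
Qed.

Lemma rnormZ (V : normedModType K) (a : K) (v : V) :
  rnorm (a *: v) = rnorm a * rnorm v.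
Proof.
by apply: scalar_of_real_inj; rewrite scalar_of_realM -!normr_rnorm normrZ.
Qed.

Lemma rnormV (a : K) : rnorm a^-1 = (rnorm a)^-1.
Proof.
have [->|a0] := eqVneq a 0; first by rewrite invr0 rnorm0 invr0.
have ra0 : rnorm a != 0 by apply: contra_neq a0 => /rnorm_eq0.
by apply: (mulfI ra0); rewrite -rnormM !divff// -scalar_of_real1
  rnorm_scalar_of_real normr1.
Qed.

Lemma cvgr_rnormP (V : pseudoMetricNormedZmodType K) (u : nat -> V) (l : V) :
  u @ \oo --> l <->
  forall e : R, 0 < e -> \forall n \near \oo, rnorm (l - u n) <= e.
Proof.
split=> [/cvgrPdist_le ul e e0|ul].
  have := ul (sc e); rewrite -scalar_of_real0 scalar_of_real_lt => /(_ e0).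
  by apply: filterS => n; rewrite normr_rnorm scalar_of_real_le.
apply/cvgrPdist_le => e e0.
(* A radius that is positive in K is automatically real. *)
have eE : e = sc (rnorm e) by rewrite -normr_rnorm gtr0_norm.
move: e0; rewrite {1}eE -scalar_of_real0 scalar_of_real_lt => /ul.
by apply: filterS => n; move=> h; rewrite eE normr_rnorm scalar_of_real_le.
Qed.

Lemma rnorm_uniformP (T : choiceType) (V : pseudoMetricNormedZmodType K)
  (u : nat -> T -> V) (f : T -> V) :
  {uniform, u @ \oo --> f} <->
  forall e : R, 0 < e ->
    \forall n \near \oo, forall t, rnorm (f t - u n t) <= e.
Proof.
split=> [uf e e0|uf].
  have sce0 : 0 < sc e by rewrite -scalar_of_real0 scalar_of_real_lt.
  apply: (uf (fun g : T -> V => forall t, rnorm (f t - g t) <= e)).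
  apply/uniform_nbhs; exists [set p | ball p.1 (sc e) p.2]; split.
    by rewrite -entourage_ballE; exists (sc e).
  move=> g /= fg t; have := fg t I; rewrite -ball_normE /=.
  by rewrite normr_rnorm scalar_of_real_lt => /ltW.
move=> P /uniform_nbhs[E []]; rewrite -entourage_ballE => -[e /= e0 eE] EP.
have eE' : e = sc (rnorm e) by rewrite -normr_rnorm gtr0_norm.
have re0 : 0 < rnorm e by rewrite -scalar_of_real_lt scalar_of_real0 -eE'.
(* The radius is halved because balls are defined by a strict inequality and [uf] gives a large
   one. *)
have /uf : 0 < rnorm e / 2 by rewrite divr_gt0.
apply: filterS => n fn; apply: EP => t _; apply: eE => /=.
rewrite -ball_normE /= normr_rnorm eE' scalar_of_real_lt.
by rewrite (le_lt_trans (fn t))// ltr_pdivrMr// ltr_pMr// ltr1n.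
Qed.

Lemma rnorm_conj a : rnorm (conj a) = rnorm a.
Proof.
apply: scalar_of_real_inj; rewrite -!normr_rnorm /scalar_conj.
by move: a; rewrite /K; case: k => //= -[a b]; rewrite !normc_def /= sqrrN.
Qed.

Lemma mul_scalar_conj a : a * conj a = sc (rnorm a ^+ 2).
Proof.
rewrite expr2 scalar_of_realM -!normr_rnorm.
move: a; rewrite /scalar_conj /K; case: k => /= a.
  by rewrite -normrM ger0_norm// -expr2 sqr_ge0.
by rewrite -expr2 sqr_normc.
Qed.

End RealValuedNorm.

(** * Inner product *)

Section InnerProduct.
Context (R : realType) (k : scalar_kind) (X : normedModType (scalar_field R k))
  (dot : {dot X for @scalar_conj R k}).
Local Notation K := (scalar_field R k).
Local Notation conj := (@scalar_conj R k).
Implicit Types x y z : X.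

Lemma dotDl x y z : dot (x + y) z = dot x z + dot y z.
Proof. exact: linearDl. Qed.

Lemma dotZl (a : K) x z : dot (a *: x) z = a * dot x z.
Proof. exact: linearZl_LR. Qed.

Lemma dotDr x y z : dot z (x + y) = dot z x + dot z y.
Proof. exact: linearDr. Qed.

Lemma dotZr (a : K) x z : dot z (a *: x) = conj a * dot z x.
Proof. exact: linearZr_LR. Qed.

Lemma dot_hermitian x y : dot x y = conj (dot y x).
Proof. by rewrite [LHS](@hermitian_subproof _ _ _ _ dot) expr0 mul1r. Qed.

Lemma dotNr x z : dot z (- x) = - dot z x.
Proof. exact: linearNr. Qed.

Lemma dotBr x y z : dot z (x - y) = dot z x - dot z y.
Proof. by rewrite dotDr dotNr. Qed.

Lemma dotBl x y z : dot (x - y) z = dot x z - dot y z.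
Proof. exact: linearBl. Qed.

Lemma dot0r z : dot z 0 = 0.
Proof. exact: linear0r. Qed.

Lemma dot0l z : dot 0 z = 0.
Proof. exact: linear0l. Qed.

Hypothesis hdot : forall x, dot x x = `|x| ^+ 2.

Lemma dot_rnorm x : dot x x = scalar_of_real (rnorm x ^+ 2).
Proof. by rewrite hdot normr_rnorm !expr2 scalar_of_realM. Qed.

(** With [w] the component of x orthogonal to y, the product of the squared norms of w and y is the
    squared right-hand side minus the squared left-hand side, and it is nonnegative. *)
Lemma cauchy_schwarz x y : rnorm (dot x y) <= rnorm x * rnorm y.
Proof.
have [->|y0] := eqVneq y 0; first by rewrite dot0r !rnorm0 mulr0.
have yy0 : dot y y != 0 by rewrite hdot expf_neq0// normr_eq0.
pose c := dot x y / dot y y; pose w := x - c *: y.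
have wy : dot w y = 0 by rewrite dotBl dotZl divfK// subrr.
have ww : dot w w * dot y y = dot x x * dot y y - dot x y * conj (dot x y).
  rewrite {2}/w dotBr dotZr wy mulr0 subr0 /w dotBl dotZl (dot_hermitian y x).
  by rewrite mulrBl (mulrAC c) divfK.
have := ww; rewrite mul_scalar_conj !dot_rnorm -!scalar_of_realM.
rewrite -scalar_of_realB => /scalar_of_real_inj wE.
rewrite -ler_sqr ?nnegrE ?mulr_ge0 ?rnorm_ge0// exprMn -subr_ge0 -wE.
by rewrite mulr_ge0// sqr_ge0.
Qed.

End InnerProduct.

(* The scalars embed in X as a line, on which dot inverts the embedding: this
   gives the completeness of K = R and of K = C at once. *)
Lemma scalar_cauchy_cvg (R : realType) (k : scalar_kind)
  (X : completeNormedModType (scalar_field R k))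
  (dot : {dot X for @scalar_conj R k}) (x0 : X)
  (z : nat -> scalar_field R k) :
  (forall x : X, dot x x = `|x| ^+ 2) -> x0 <> 0 ->
  (forall e : R, 0 < e ->
    exists N, forall m n, (N <= m)%N -> (N <= n)%N -> rnorm (z m - z n) <= e) ->
  exists l : scalar_field R k, z @ \oo --> l.
Proof.
move=> hdot /eqP x0n zc.
have rx0 : 0 < rnorm x0.
  by rewrite lt_def rnorm_ge0 andbT; apply: contra_neq x0n; exact: rnorm_eq0.
have cz : cvg ((fun n => z n *: x0) @ \oo).
  apply: cauchy_cvg; apply: cauchy_exP => e e0.
  have eE : e = scalar_of_real (rnorm e) by rewrite -normr_rnorm gtr0_norm.
  have re0 : 0 < rnorm e.
    by rewrite -(@scalar_of_real_lt R k) scalar_of_real0 -eE.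
  have [|N NP] := zc (rnorm e / 2 / rnorm x0); first by rewrite !divr_gt0.
  exists (z N *: x0); exists N => // n /= Nn.
  rewrite -ball_normE /= -scalerBl normr_rnorm eE scalar_of_real_lt rnormZ.
  apply: (@le_lt_trans _ _ (rnorm e / 2)).
    by rewrite -ler_pdivlMr// NP.
  by rewrite ltr_pdivrMr// ltr_pMr// ltr1n.
pose y := lim ((fun n => z n *: x0) @ \oo).
exists (dot y x0 / dot x0 x0); apply/cvgr_rnormP => e e0.
have x00 : dot x0 x0 != 0 by rewrite hdot expf_neq0// normr_eq0.
have /cvgr_rnormP/(_ (e * rnorm x0)) := cz.
rewrite mulr_gt0// => /(_ isT); apply: filterS => n /= yn.
have -> : dot y x0 / dot x0 x0 - z n = dot (y - z n *: x0) x0 / dot x0 x0.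
  by rewrite dotBl dotZl mulrBl mulfK.
rewrite rnormM rnormV dot_rnorm// rnorm_scalar_of_real normrX.
rewrite ger0_norm ?rnorm_ge0// ler_pdivrMr ?exprn_gt0//.
rewrite (le_trans (cauchy_schwarz hdot _ _))// expr2 mulrA.
by rewrite ler_wpM2r ?rnorm_ge0.
Qed.

(** * Borel sets and vector measures *)

Section BorelSets.
Context (T : topologicalType).
Implicit Types A B : set T.

Lemma borel_open A : open A -> borel A.
Proof. exact: sub_sigma_algebra. Qed.

Lemma borel0 : borel (set0 : set T).
Proof. exact: sigma_algebra0. Qed.

Lemma borelC A : borel A -> borel (~` A).
Proof. by move=> bA; rewrite -setTD; exact: sigma_algebraCD. Qed.

Lemma borelT : borel (setT : set T).
Proof. by apply: borel_open; exact: openT. Qed.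

Lemma borel_closed A : closed A -> borel A.
Proof. by move=> cA; rewrite -(setCK A); apply: borelC; apply: borel_open;
  exact: closed_openC. Qed.

Lemma borel_bigcup (F : (set T)^nat) :
  (forall n, borel (F n)) -> borel (\bigcup_n F n).
Proof. exact: sigma_algebra_bigcup. Qed.

Lemma borelU A B : borel A -> borel B -> borel (A `|` B).
Proof.
move=> bA bB; rewrite -bigcup2E; apply: borel_bigcup => -[|[|n]]//=.
exact: borel0.
Qed.

Lemma borelI A B : borel A -> borel B -> borel (A `&` B).
Proof.
by move=> bA bB; rewrite -(setCK (_ `&` _)) setCI; apply: borelC;
  apply: borelU; exact: borelC.
Qed.

Lemma borelD A B : borel A -> borel B -> borel (A `\` B).
Proof. by move=> bA bB; rewrite setDE; exact: (borelI bA (borelC bB)). Qed.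

End BorelSets.

Section Measures.
Context (R : realType) (k : scalar_kind) (T : topologicalType)
  (X : normedModType (scalar_field R k)).
Implicit Types (mu nu : cabv T X) (A B : set T).

Lemma cabvP mu : is_cabv mu.
Proof. by case: mu => m /= /asboolP. Qed.

Lemma cabv_nonborel mu A : ~ borel A -> mu A = 0.
Proof. by case: (cabvP mu) => + _ _; exact. Qed.

Lemma cabv_sigma_additive mu : vsigma_additive mu.
Proof. by case: (cabvP mu). Qed.

Lemma cabv_eqP mu nu : (forall A, borel A -> mu A = nu A) -> mu = nu.
Proof.
move=> munu; apply: val_inj; apply/funext => A /=.
by have [/munu//|nA] := pselect (borel A); rewrite !cabv_nonborel.
Qed.

Lemma cabvDE mu nu A : cabv_val (mu + nu) A = mu A + nu A.
Proof. by []. Qed.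

Lemma cabvZE (a : scalar_field R k) mu A : cabv_val (a *: mu) A = a *: mu A.
Proof. by []. Qed.

Lemma cabvBE mu nu A : cabv_val (mu - nu) A = mu A - nu A.
Proof. by []. Qed.

Lemma cabv0E A : cabv_val (0 : cabv T X) A = 0.
Proof. by []. Qed.

(** Applied to the constant sequence of empty sets, sigma-additivity makes the multiples of
    [mu set0] converge. Consecutive partial sums then become arbitrarily close, and they differ by
    [mu set0]. *)
Lemma cabv_set0 mu : mu set0 = 0.
Proof.
have tr : trivIset setT (fun _ : nat => set0 : set T).
  by move=> i j _ _ [x []].
have /cvgr_rnormP h := @cabv_sigma_additive mu (fun=> set0)
  (fun=> @borel0 T) tr.
rewrite bigcup0// in h.
apply: rnorm_eq0; apply/le_anti; rewrite rnorm_ge0 andbT.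
apply/ler_addgt0Pl => e e0; rewrite addr0.
have [|N _ NP] := h (e / 2); first by rewrite divr_gt0.
have /= := lerD (NP N (leqnn N)) (NP N.+1 (leqnSn N)).
rewrite -splitr big_nat_recr//= rnormBC; apply: le_trans.
rewrite addrC; apply: le_trans (rnormD _ _).
by rewrite opprD (addrA (mu _)) subrr add0r addrAC subrr add0r rnormN.
Qed.

Lemma cabvU mu A B : borel A -> borel B -> A `&` B = set0 ->
  mu (A `|` B) = mu A + mu B.
Proof.
move=> bA bB AB; have := @cabv_sigma_additive mu (bigcup2 A B).
rewrite bigcup2E => /(_ _ _)/cvg_unique; apply => //.
- by move=> [|[|n]] //=; exact: borel0.
- by rewrite -trivIset_bigcup2.
- apply: cvg_near_cst; exists 2%N => // n /= n2.
  rewrite -(subnKC n2) /index_iota subn0 iotaD big_cat /= !big_cons big_nil.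
  rewrite big_seq big1 ?addr0// => i; rewrite mem_iota => /andP[].
  by case: i => [|[|i]]//= _ _; rewrite cabv_set0.
Qed.

Lemma cabv_split B mu A : borel A -> borel B ->
  mu A = mu (A `&` B) + mu (A `\` B).
Proof.
move=> bA bB; rewrite -cabvU ?setUIDK//; [exact: borelI|exact: borelD|].
by rewrite setDE setIACA setICr setI0.
Qed.

Lemma cabvC mu A : borel A -> mu (~` A) = mu setT - mu A.
Proof.
by move=> bA; rewrite (cabv_split mu (@borelT T) bA) setTI setTD addrAC subrr
  add0r.
Qed.

Lemma cabv_nondecreasing mu (F : (set T)^nat) : (forall n, borel (F n)) ->
  nondecreasing_seq F -> (fun n => mu (F n)) @ \oo --> mu (\bigcup_n F n).
Proof.
move=> bF ndF.
have bD n : borel (seqD F n) by case: n => [|n] //=; exact: borelD.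
(* The successive differences telescope; the sum needs n + 1 terms to reach [F n], whence the shift
   of the limit below. *)
have sE n : \sum_(0 <= i < n.+1) mu (seqD F i) = mu (F n).
  elim: n => [|n ih]; first by rewrite big_nat1.
  rewrite big_nat_recr//= ih (@cabv_split (F n) mu (F n.+1))//.
  congr (mu _ + _); apply/esym/setIidPr; exact/subsetPset/ndF.
have := @cabv_sigma_additive mu (seqD F) bD (trivIset_seqD ndF).
rewrite eq_bigcup_seqD -(cvg_shiftS (fun n => \sum_(0 <= i < n) _)) /=.
by under eq_fun do rewrite sE.
Qed.

Lemma cabv_nonincreasing mu (F : (set T)^nat) : (forall n, borel (F n)) ->
  nonincreasing_seq F -> (fun n => mu (F n)) @ \oo --> mu (\bigcap_n F n).
Proof.
move=> bF niF; have bFC n : borel (~` F n) by exact: borelC.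
have : (fun n => mu setT - mu (~` F n)) @ \oo -->
    mu setT - mu (\bigcup_n ~` F n).
  apply: cvgB; first exact: cvg_cst.
  apply: cabv_nondecreasing => // m n mn.
  by apply/subsetPset/subsetC/subsetPset/niF.
rewrite -cabvC ?setC_bigcup//; last exact: borel_bigcup.
under eq_fun do rewrite -cabvC// setCK.
by under eq_bigcapr do rewrite setCK.
Qed.

(** The partition of B is listed after that of A, with indices shifted by n. This lets a bound for
    simple functions be proved piece by piece. *)
Lemma variation_sums_cat mu A B s t : A `&` B = set0 ->
  variation_sums mu A s -> variation_sums mu B t ->
  variation_sums mu (A `|` B) (s + t).
Proof.
move=> AB [n [P [bP tP UP ->]]] [m [Q [bQ tQ UQ ->]]].
have PA i : (i < n)%N -> P i `<=` A by move=> ni x Px; rewrite -UP; exists i.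
have QB i : (i < m)%N -> Q i `<=` B by move=> ni x Px; rewrite -UQ; exists i.
have dAB x : A x -> B x -> False by move=> Ax Bx; rewrite -[False]/(set0 x) -AB.
exists (n + m)%N, (fun i => if (i < n)%N then P i else Q (i - n)%N); split.
- move=> i inm; case: ltnP => [/bP//|ni]; apply: bQ.
  by rewrite ltn_subLR.
- apply/trivIsetP => i j /= inm jnm ij; apply/seteqP; split => // x [].
  case: ltnP => ni; case: ltnP => nj.
  + move=> Pi Pj; move/trivIsetP: tP => /(_ i j ni nj ij).
    by move=> <-; split.
  + by move=> /(PA _ ni) Ax /(QB _ _)Bx; apply: (dAB x Ax); apply: Bx;
    rewrite ltn_subLR.
  + by move=> /(QB _ _)Bx /(PA _ nj) Ax; apply: (dAB x Ax); apply: Bx;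
    rewrite ltn_subLR.
  + move=> Pi Pj; move/trivIsetP: tQ => /(_ (i - n)%N (j - n)%N) <-;
    first by split.
    * by rewrite /= ltn_subLR.
    * by rewrite /= ltn_subLR.
    * by apply: contra_neq ij => /eqP; rewrite eqn_sub2rE// => /eqP.
- rewrite -UP -UQ; apply/seteqP; split => x.
    move=> [i /= inm]; case: ltnP => ni xi; first by left; exists i.
    by right; exists (i - n)%N => //=; rewrite ltn_subLR.
  move=> [[i /= ni xi]|[i /= ni xi]].
    by exists i; rewrite /= ?ni// ltn_addr.
  exists (n + i)%N; first by rewrite /= ltn_add2l.
  by rewrite ltnNge leq_addr/= addKn.
- rewrite big_split_ord /=; congr (_ + _); apply: eq_bigr => i _.
    by rewrite ltn_ord.
  by rewrite ltnNge leq_addr/= addKn.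
Qed.

Lemma variation_sums1 mu A : borel A -> variation_sums mu A (rnorm (mu A)).
Proof.
move=> bA; exists 1%N, (fun=> A); split => //.
- by move=> i j /=; rewrite !ltnS !leqn0 => /eqP -> /eqP ->.
- by apply/seteqP; split => [x []//|x Ax]; exists 0%N.
- by rewrite big_ord1.
Qed.

Lemma var_norm_ge mu s : variation_sums mu setT s -> s <= var_norm mu.
Proof.
move=> sm; have [_ _ fin] := cabvP mu.
have : (s%:E <= Defs.variation mu setT)%E by apply: ereal_sup_ubound; exists s.
by rewrite /var_norm; case: (Defs.variation mu setT) fin => // [r _|_];
  rewrite ?lee_fin// leeNy_eq.
Qed.

Lemma var_norm_le mu M : (forall s, variation_sums mu setT s -> s <= M) ->
  var_norm mu <= M.
Proof.
move=> muM.
have : (Defs.variation mu setT <= M%:E)%E.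
  by apply: ge_ereal_sup => _ [s /muM sM <-]; rewrite lee_fin.
(* The one-piece partition excludes the value -oo, which [fine] would turn into 0. *)
have : ((rnorm (mu setT))%:E <= Defs.variation mu setT)%E.
  apply: ereal_sup_ubound; exists (rnorm (mu setT)) => //.
  by apply: variation_sums1; exact: borelT.
rewrite /var_norm; case: (Defs.variation mu setT) => [r _||];
  first by rewrite lee_fin.
  by rewrite leye_eq.
by rewrite leeNy_eq.
Qed.

Lemma rnorm_setT_le_var_norm mu : rnorm (mu setT) <= var_norm mu.
Proof. by apply: var_norm_ge; apply: variation_sums1; exact: borelT. Qed.

Lemma var_norm_ge0 mu : 0 <= var_norm mu.
Proof. exact: le_trans (rnorm_ge0 _) (rnorm_setT_le_var_norm mu). Qed.

Lemma var_norm_comb (a : scalar_field R k) mu nu :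
  var_norm (a *: mu + nu) <= rnorm a * var_norm mu + var_norm nu.
Proof.
apply: var_norm_le => _ [n [P [bP tP UP ->]]].
have h (m : cabv T X) : \sum_(i < n) rnorm (m (P i)) <= var_norm m.
  by apply: var_norm_ge; exists n, P.
apply: (@le_trans _ _ (\sum_(i < n) (rnorm a * rnorm (mu (P i)) + rnorm (nu (P
  i))))).
  by apply: ler_sum => i _; exact: rnorm_comb.
by rewrite big_split /= -mulr_sumr lerD// ler_wpM2l// rnorm_ge0.
Qed.

Lemma var_norm0 : var_norm (0 : cabv T X) = 0.
Proof.
apply/le_anti; rewrite var_norm_ge0 andbT.
by apply: var_norm_le => _ [n [P [_ _ _ ->]]]; rewrite big1// => i _;
  rewrite rnorm0.
Qed.

Lemma var_normZ (a : scalar_field R k) mu :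
  var_norm (a *: mu) <= rnorm a * var_norm mu.
Proof. by rewrite -[a *: mu]addr0 (le_trans (var_norm_comb _ _ _))// var_norm0
  addr0. Qed.

Lemma var_normD mu nu : var_norm (mu + nu) <= var_norm mu + var_norm nu.
Proof.
rewrite -[mu in leLHS]scale1r (le_trans (var_norm_comb _ _ _))//.
by rewrite -(@scalar_of_real1 R k) rnorm_scalar_of_real normr1 mul1r.
Qed.

End Measures.

(** * Integration of uniform limits of simple functions *)

Section SimpleFunctions.
Context (R : realType) (k : scalar_kind) (T : metricType R)
  (X : completeNormedModType (scalar_field R k))
  (dot : {dot X for @scalar_conj R k}).
Hypothesis hdot : forall x : X, dot x x = `|x| ^+ 2.
Local Notation K := (scalar_field R k).
Local Notation conj := (@scalar_conj R k).
Implicit Types (mu nu : cabv T X) (A B : set T) (s : seq (set T * X)).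
Implicit Types (f g : T -> X).

Definition borel_seq s := forall p, p \in s -> borel p.1.

Lemma simple_eval_cons p s t :
  simple_eval (p :: s) t = (\1_(p.1) t : K) *: p.2 + simple_eval s t.
Proof. by rewrite /simple_eval big_cons. Qed.

Lemma simple_eval_cat s s' t :
  simple_eval (s ++ s') t = simple_eval s t + simple_eval s' t.
Proof. by rewrite /simple_eval big_cat. Qed.

Lemma simple_integral_cat mu s s' : simple_integral dot mu (s ++ s') =
  simple_integral dot mu s + simple_integral dot mu s'.
Proof. by rewrite /simple_integral big_cat. Qed.

Lemma borel_seq_cat s s' : borel_seq s -> borel_seq s' -> borel_seq (s ++ s').
Proof. by move=> bs bs' p; rewrite mem_cat => /orP[/bs|/bs']. Qed.

Definition simple_scale (a : K) s := [seq (p.1, a *: p.2) | p <- s].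

Lemma simple_eval_scale a s t :
  simple_eval (simple_scale a s) t = a *: simple_eval s t.
Proof.
rewrite /simple_eval big_map scaler_sumr; apply: eq_bigr => p _ /=.
by rewrite !scalerA mulrC.
Qed.

Lemma simple_integral_scale mu a s :
  simple_integral dot mu (simple_scale a s) = a * simple_integral dot mu s.
Proof.
by rewrite /simple_integral big_map mulr_sumr; apply: eq_bigr => p _ /=;
  rewrite dotZl.
Qed.

Lemma borel_seq_scale a s : borel_seq s -> borel_seq (simple_scale a s).
Proof. by move=> bs p /mapP[q /bs bq ->]. Qed.

Lemma simple_integral_measure_comb (a : K) mu nu s :
  simple_integral dot (a *: mu + nu) s =
  conj a * simple_integral dot mu s + simple_integral dot nu s.
Proof.
rewrite /simple_integral mulr_sumr -big_split; apply: eq_bigr => p _.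
by rewrite cabvDE cabvZE dotDr dotZr.
Qed.

(* B is cut along the sets of s one after the other; on each final piece the
   function c + s is constant. *)
Lemma simple_integral_on_bound mu s B (c : X) (M : R) :
  borel_seq s -> borel B -> 0 <= M ->
  (forall t, B t -> rnorm (c + simple_eval s t) <= M) ->
  exists2 v, variation_sums mu B v &
    rnorm (dot c (mu B) + \sum_(p <- s) dot p.2 (mu (p.1 `&` B))) <= M * v.
Proof.
elim: s B c => [|[A x] s ih] B c bs bB M0 hM.
  exists (rnorm (mu B)); first exact: variation_sums1.
  rewrite big_nil addr0 (le_trans (cauchy_schwarz hdot _ _))//.
  (* An empty piece has no point at which to read off the bound on c, but its measure is 0. *)
  have [->|/set0P[t Bt]] := eqVneq B set0;
    first by rewrite cabv_set0 rnorm0 !mulr0.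
  rewrite ler_wpM2r ?rnorm_ge0//; have := hM t Bt.
  by rewrite /simple_eval big_nil addr0.
have bA : borel A by exact: (bs (A, x)) (mem_head _ _).
have {}bs : borel_seq s by move=> p ps; apply: bs; rewrite inE ps orbT.
(* Inside [A] the head pair adds x to the constant; outside [A] it contributes nothing and the
   constant stays c. *)
have [t [Bt At]|v1 v1B h1] := ih (B `&` A) (c + x) bs (borelI bB bA) M0.
  by have := hM t Bt; rewrite simple_eval_cons indicE mem_set//= scale1r addrA.
have [t [Bt At]|v2 v2B h2] := ih (B `\` A) c bs (borelD bB bA) M0.
  by have := hM t Bt; rewrite simple_eval_cons indicE memNset//= scale0r add0r.
exists (v1 + v2).
  rewrite -(setUIDK B A); apply: variation_sums_cat => //.
  by rewrite setDE setIACA setICr setI0.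
rewrite mulrDr (le_trans _ (lerD h1 h2))// (le_trans _ (rnormD _ _))//.
rewrite le_eqVlt; apply/orP; left; apply/eqP; congr rnorm.
rewrite big_cons /= (setIC A) addrA.
rewrite [in LHS](cabv_split mu bB bA) dotDr.
have -> : \sum_(p <- s) dot p.2 (mu (p.1 `&` B)) =
  \sum_(p <- s) dot p.2 (mu (p.1 `&` (B `&` A))) +
  \sum_(p <- s) dot p.2 (mu (p.1 `&` (B `\` A))).
  rewrite -big_split /= !big_seq; apply: eq_bigr => p ps.
  by rewrite -dotDr (cabv_split mu (borelI (bs _ ps) bB) bA) setIA setIDA.
rewrite dotDl; ring.
Qed.

Lemma simple_integral_bound mu s (M : R) : borel_seq s -> 0 <= M ->
  (forall t, rnorm (simple_eval s t) <= M) ->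
  rnorm (simple_integral dot mu s) <= M * var_norm mu.
Proof.
move=> bs M0 sM.
have [|v vT] := simple_integral_on_bound mu (c := 0) bs (@borelT T) M0.
  by move=> t _; rewrite add0r.
rewrite dot0l add0r; under eq_bigr do rewrite setIT.
by move=> h; rewrite (le_trans h)// ler_wpM2l// var_norm_ge.
Qed.

Lemma simple_integral_dist mu s s' (M : R) : borel_seq s -> borel_seq s' ->
  0 <= M -> (forall t, rnorm (simple_eval s t - simple_eval s' t) <= M) ->
  rnorm (simple_integral dot mu s - simple_integral dot mu s') <=
    M * var_norm mu.
Proof.
move=> bs bs' M0 h.
rewrite -(mulN1r (simple_integral _ _ s')) -simple_integral_scale.
rewrite -simple_integral_cat; apply: simple_integral_bound => //.
  by apply: borel_seq_cat => //; exact: borel_seq_scale.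
by move=> t; rewrite simple_eval_cat simple_eval_scale scaleN1r.
Qed.

End SimpleFunctions.

Lemma rnorm_small_eq0 (R : realType) (k : scalar_kind)
    (V : normedZmodType (scalar_field R k)) (C : R) (v : V) :
  (forall e : R, 0 < e -> rnorm v <= C * e) -> v = 0.
Proof.
move=> h; apply: rnorm_eq0; apply/le_anti; rewrite rnorm_ge0 andbT.
apply/ler_addgt0Pl => e e0; rewrite addr0.
(* No sign is assumed for C, so it is replaced by a positive majorant before dividing. *)
have C1 : 0 < `|C| + 1 by rewrite ltr_wpDl.
rewrite (le_trans (h (e / (`|C| + 1)) _)) ?divr_gt0//.
rewrite mulrCA ger_pMr// ler_pdivrMr// mul1r.
by rewrite (le_trans (ler_norm _))// lerDl.
Qed.

(** * The integral: existence, norm bound, linearity in both arguments *)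

Section Integral.
Context (R : realType) (k : scalar_kind) (T : metricType R)
  (X : completeNormedModType (scalar_field R k))
  (dot : {dot X for @scalar_conj R k}).
Hypothesis hdot : forall x : X, dot x x = `|x| ^+ 2.
Hypothesis hX : exists x : X, x <> 0.
Local Notation K := (scalar_field R k).
Local Notation conj := (@scalar_conj R k).
Implicit Types (mu nu : cabv T X) (A B : set T) (s : seq (set T * X)).
Implicit Types (f g : T -> X).

Definition approximates (e : R) f s :=
  borel_seq s /\ forall t, rnorm (f t - simple_eval s t) <= e.

Definition totally_measurable f :=
  forall e : R, 0 < e -> exists s, approximates e f s.

(** Approximations within 1/(n+1) have integrals forming a Cauchy sequence, by
    [simple_integral_dist], and the scalars are complete. *)
Lemma is_integral_ex mu f : totally_measurable f ->
  exists l, is_integral dot mu f l.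
Proof.
move=> mf; have /choice[s sP] n : exists s, approximates n.+1%:R^-1 f s.
  by apply: mf; rewrite invr_gt0.
have V0 : 0 < var_norm mu + 1 by rewrite ltr_wpDl// var_norm_ge0.
have small (e : R) : 0 < e -> exists N, forall n, (N <= n)%N -> n.+1%:R^-1 <= e.
  move=> e0; exists (Num.truncn e^-1) => n Nn.
  rewrite -[e]invrK lef_pV2 ?posrE ?invr_gt0 ?ltr0n//.
  by rewrite (le_trans (ltW (truncnS_gt _)))// ler_nat.
have [x0 x0n] := hX.
have [|l sl] := @scalar_cauchy_cvg R k X dot x0
  (fun n => simple_integral dot mu (s n)) hdot x0n.
  move=> e e0; have [|N NP] := small (e / 2 / (var_norm mu + 1)).
    by rewrite !divr_gt0.
  exists N => m n Nm Nn.
  have [[bm sm] [bn sn]] := (sP m, sP n).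
  rewrite (@le_trans _ _ (e / (var_norm mu + 1) * var_norm mu))//; last first.
    by rewrite mulrAC ler_pdivrMr// ler_wpM2l ?ltW// ltrDl.
  apply: simple_integral_dist => //; first by rewrite divr_ge0// ltW.
  move=> t; rewrite (le_trans (rnorm_distD (f t) _ _))//.
  rewrite rnormBC (splitr e) mulrDl lerD//.
    exact: le_trans (sm t) (NP _ Nm).
  exact: le_trans (sn t) (NP _ Nn).
exists l, s; split => //; first by move=> n; case: (sP n).
apply/rnorm_uniformP => e /small[N NP]; exists N => // n /= Nn t.
by have [_ sn] := sP n; rewrite (le_trans (sn t))// NP.
Qed.

(** [integral] is only a chosen limit along some unknown sequence; comparing [s] with a late term of
    that sequence controls it by any approximation. The further properties of the integral are read
    off from this estimate. *)
Lemma integral_approx mu f e s : totally_measurable f -> 0 <= e ->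
  approximates e f s ->
  rnorm (Defs.integral dot mu f - simple_integral dot mu s) <= e * var_norm mu.
Proof.
move=> mf e0 [bs sf].
have [s' [bs' /rnorm_uniformP us' /cvgr_rnormP cs']] : is_integral dot mu f
  (Defs.integral dot mu f).
  exact: xgetPex (is_integral_ex mu mf).
apply/ler_addgt0Pl => d d0.
have V0 : 0 < var_norm mu + 1 by rewrite ltr_wpDl// var_norm_ge0.
have d'0 : 0 < d / (var_norm mu + 1) by rewrite divr_gt0.
have [N _ NP] : \forall n \near \oo,
    (forall t, rnorm (f t - simple_eval (s' n) t) <= d / (var_norm mu + 1)) /\
    rnorm (Defs.integral dot mu f - simple_integral dot mu (s' n)) <= d /
      (var_norm mu + 1).
  by near=> n; split; near: n; [exact: us'|exact: cs'].
have [h1 h2] := NP N (leqnn N).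
rewrite (le_trans (rnorm_distD (simple_integral dot mu (s' N)) _ _))//.
have -> : d + e * var_norm mu = d / (var_norm mu + 1) +
    (d / (var_norm mu + 1) + e) * var_norm mu.
  by field; rewrite gt_eqF.
rewrite lerD//; apply: simple_integral_dist => //; first exact: bs'.
  by rewrite addr_ge0// ltW.
move=> t; rewrite (le_trans (rnorm_distD (f t) _ _))// lerD// rnormBC.
exact: h1.
Unshelve. all: by end_near. Qed.

Lemma integral_bound mu f (M : R) : totally_measurable f -> 0 <= M ->
  (forall t, rnorm (f t) <= M) -> rnorm (Defs.integral dot mu f) <= M *
    var_norm mu.
Proof.
move=> mf M0 fM; apply/ler_addgt0Pl => d d0.
have V0 : 0 < 2 * (var_norm mu + 1) by rewrite mulr_gt0// ltr_wpDl//
  var_norm_ge0.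
(* The error e is paid twice: in replacing f by s, and in the bound e + M on the values of s. The
   added 1 avoids dividing by a zero variation. *)
have [e e0 eE] : exists2 e, 0 < e & d = e * (2 * (var_norm mu + 1)).
  by exists (d / (2 * (var_norm mu + 1))); rewrite ?divr_gt0// divfK// gt_eqF.
have [s sf] := mf _ e0.
have h1 := integral_approx mu mf (ltW e0) sf.
have [bs sfe] := sf.
have h2 : rnorm (simple_integral dot mu s) <= (e + M) * var_norm mu.
  apply: simple_integral_bound => //; first by rewrite addr_ge0// ltW.
  move=> t; rewrite -[simple_eval s t](subrK (f t)) (le_trans (rnormD _ _))//
    lerD//.
  by rewrite rnormBC.
rewrite -[Defs.integral _ _ _](subrK (simple_integral dot mu s)).
rewrite (le_trans (rnormD _ _))// (le_trans (lerD h1 h2))//.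
rewrite mulrDl addrA lerD2r -mulrDl.
by rewrite eE; nra.
Qed.

Lemma approximates_comb (a : K) e1 e2 f g s1 s2 :
  approximates e1 f s1 -> approximates e2 g s2 ->
  approximates (rnorm a * e1 + e2) (fun t => a *: f t + g t)
    (simple_scale a s1 ++ s2).
Proof.
move=> [b1 h1] [b2 h2]; split; first by apply: borel_seq_cat => //;
  exact: borel_seq_scale.
move=> t; rewrite simple_eval_cat simple_eval_scale opprD addrACA -scalerBr.
by rewrite (le_trans (rnormD _ _))// lerD// rnormZ ler_wpM2l ?rnorm_ge0.
Qed.

Lemma totally_measurable_comb (a : K) f g : totally_measurable f ->
  totally_measurable g -> totally_measurable (fun t => a *: f t + g t).
Proof.
move=> mf mg e e0; have a1 : 0 < rnorm a + 1 by rewrite ltr_wpDl// rnorm_ge0.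
have d0 : 0 < e / (rnorm a + 1) by rewrite divr_gt0.
have [[s1 sf] [s2 sg]] := (mf _ d0, mg _ d0).
exists (simple_scale a s1 ++ s2).
have := approximates_comb a sf sg.
suff -> : rnorm a * (e / (rnorm a + 1)) + e / (rnorm a + 1) = e by [].
by field; rewrite gt_eqF.
Qed.

Lemma integral_comb mu (a : K) f g : totally_measurable f ->
  totally_measurable g ->
  Defs.integral dot mu (fun t => a *: f t + g t) =
  a * Defs.integral dot mu f + Defs.integral dot mu g.
Proof.
move=> mf mg; apply/eqP; rewrite -subr_eq0; apply/eqP.
(* One factor [rnorm a + 1] is the error of the combined approximation, the other that of the two
   separate ones. *)
apply: (@rnorm_small_eq0 _ _ _ ((rnorm a + 1 + (rnorm a + 1)) * var_norm mu)).
move=> e e0; have [[s1 sf] [s2 sg]] := (mf e e0, mg e e0).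
have h1 := integral_approx mu mf (ltW e0) sf.
have h2 := integral_approx mu mg (ltW e0) sg.
have a0 := rnorm_ge0 a.
have e'0 : 0 <= rnorm a * e + e by rewrite addr_ge0 ?mulr_ge0// ltW.
have h3 := integral_approx mu (totally_measurable_comb a mf mg) e'0
  (approximates_comb a sf sg).
move: h3; rewrite simple_integral_cat simple_integral_scale => h3.
rewrite (le_trans (rnorm_distD
  (a * simple_integral dot mu s1 + simple_integral dot mu s2) _ _))//.
rewrite [leRHS](_ : _ = (rnorm a * e + e) * var_norm mu +
  (rnorm a * (e * var_norm mu) + e * var_norm mu)); last by ring.
rewrite lerD//.
rewrite opprD addrACA -mulrBr (le_trans (rnormD _ _))//.
by rewrite lerD//; [rewrite rnormM rnormBC ler_wpM2l|rewrite rnormBC].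
Qed.

Lemma integral_measure_comb (a : K) mu nu f : totally_measurable f ->
  Defs.integral dot (a *: mu + nu) f =
  conj a * Defs.integral dot mu f + Defs.integral dot nu f.
Proof.
move=> mf; apply/eqP; rewrite -subr_eq0; apply/eqP.
apply: (@rnorm_small_eq0 _ _ _ (var_norm (a *: mu + nu) + (rnorm a * var_norm
  mu + var_norm nu))).
move=> e e0; have [s sf] := mf e e0.
have h m := integral_approx m mf (ltW e0) sf.
rewrite (le_trans (rnorm_distD (simple_integral dot (a *: mu + nu) s) _ _))//.
rewrite mulrDl lerD//; first by rewrite mulrC.
rewrite simple_integral_measure_comb opprD addrACA -mulrBr.
rewrite (le_trans (rnormD _ _))// mulrDl lerD//; last by rewrite rnormBC mulrC.
by rewrite rnormM rnorm_conj rnormBC -mulrA ler_wpM2l ?rnorm_ge0// mulrC.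
Qed.

(** With error 0, [integral_approx] yields the exact value of the integral of a constant. *)
Lemma approximates_cst (x : X) : approximates 0 (fun=> x) [:: (setT, x)].
Proof.
split=> [p|t]; first by rewrite inE => /eqP -> /=; exact: borelT.
by rewrite /simple_eval big_seq1 indicE in_setT scale1r subrr rnorm0.
Qed.

Lemma totally_measurable_cst (x : X) : totally_measurable (fun=> x).
Proof.
move=> e e0; exists [:: (setT, x)]; have [bs h] := approximates_cst x.
by split => // t; rewrite (le_trans (h t))// ltW.
Qed.

Lemma integral_constant mu (x : X) : Defs.integral dot mu (fun=> x) = dot x (mu
  setT).
Proof.
have := integral_approx mu (totally_measurable_cst x) (lexx _)
  (approximates_cst x).
rewrite /simple_integral big_seq1 mul0r /= => h.
by apply/eqP; rewrite -subr_eq0; apply/eqP; apply: rnorm_eq0; apply/le_anti;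
  rewrite h rnorm_ge0.
Qed.

End Integral.

(** * Finite nets and the diameter of a compact metric space *)

Lemma metric_ball_open (R : realType) (T : metricType R) (x : T) (r : R) :
  open (ball x r).
Proof.
rewrite openE => y; rewrite ballEmdist /= => xy.
apply/nbhs_ballP; exists (r - mdist x y) => /=; first by rewrite subr_gt0.
move=> z; rewrite !ballEmdist /= ltrBrDl; apply: le_lt_trans.
exact: metric_triangle.
Qed.

Lemma compact_finite_net (R : realType) (T : metricType R) (r : R) :
  compact [set: T] -> 0 < r ->
  exists l : seq T, forall t, exists2 a, a \in l & mdist a t < r.
Proof.
move=> /compact_near_coveringP cT r0.
(* Finite lists are directed by inclusion. Each point t has a neighbourhood, its ball, that is
   covered by every list containing t; near-covering compactness makes the choice of list uniform in
   t. *)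
pose F : set_system (seq T) :=
  filter_from setT (fun l0 : seq T => [set l : seq T | {subset l0 <= l}]).
have FF : Filter F.
  apply: filter_from_filter; first by exists [::].
  move=> l1 l2 _ _; exists (l1 ++ l2) => // l /= l12.
  by split => a al; apply: l12; rewrite mem_cat al ?orbT.
pose P (l : seq T) (t : T) := exists2 a, a \in l & mdist a t < r.
have [t _|l0 _ l0P] := cT _ F P FF.
  exists (ball t r, [set l : seq T | {subset [:: t] <= l}]) => /=.
    by split; [exact: nbhsx_ballx|exists [:: t]].
  move=> -[t' l] [/=]; rewrite ballEmdist => tt' tl; exists t => //.
  by apply: tl; rewrite inE.
by exists l0 => t; exact: (l0P l0).
Qed.

Section Diameter.
Context (R : realType) (T : metricType R).
Hypothesis hT : compact [set: T].
Implicit Types s t : T.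

Lemma mdist_le_diam s t : mdist s t <= diam T.
Proof.
have [l lP] := compact_finite_net hT ltr01.
(* A real supremum bounds its set only if that set is bounded. Any two points are within 1 of net
   points, whose mutual distance is a term of the sum M; hence the bound 1 + M + 1. *)
pose M := \sum_(a <- l) \sum_(b <- l) mdist a b.
apply: sup_upper_bound; last by exists (s, t).
split; first by exists (mdist s t), (s, t).
exists (1 + M + 1) => _ [[x y] _ <-] /=.
have [[a al ax] [b bl yb]] := (lP x, lP y).
rewrite (le_trans (metric_triangle _ b _))// lerD//; last by rewrite ltW.
rewrite (le_trans (metric_triangle _ a _))// lerD//;
  first by rewrite metric_sym ltW.
rewrite /M (big_rem a al) /= (big_rem b bl) /= -addrA lerDl addr_ge0//.
  by apply: sumr_ge0 => i _; exact: mdist_ge0.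
by apply: sumr_ge0 => i _; apply: sumr_ge0 => j _; exact: mdist_ge0.
Qed.

Lemma diam_ge0 : inhabited T -> 0 <= diam T.
Proof. by move=> [t]; rewrite -(mdistxx t) mdist_le_diam. Qed.

End Diameter.

(** * Lipschitz functions and their approximation by simple functions *)

Section Lipschitz.
Context (R : realType) (k : scalar_kind) (T : metricType R)
  (X : normedModType (scalar_field R k)).
Implicit Types (f g : T -> X) (c : R).

(** The infimum of the Lipschitz constants is attained: at a given pair s, t, a constant within e /
    (mdist s t + 1) of it gives the inequality up to e. *)
Lemma L1P f : L1 f <-> lipschitz_const 1 f.
Proof.
split=> [[[c cf] f1]|f1]; last first.
  split; first by exists 1.
  by apply: ge_inf => //; exists 0 => c [].
split => // s t; rewrite mul1r; apply/ler_addgt0Pl => e e0.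
have d0 : 0 < e / (mdist s t + 1) by rewrite divr_gt0// ltr_wpDl// mdist_ge0.
have [|d [d'0 df] d1] := @inf_adherent R [set c | lipschitz_const c f] _ d0.
  by split; [exists c|exists 0 => ? []].
rewrite (le_trans (df s t))//.
have {}d1 : d <= 1 + e / (mdist s t + 1) by rewrite ltW// (lt_le_trans d1)//
  lerD2r.
rewrite (le_trans (ler_wpM2r (mdist_ge0 _ _) d1))// mulrDl mul1r addrC lerD2r.
by rewrite mulrAC ler_pdivrMr ?ltr_wpDl ?mdist_ge0// ler_wpM2l ?ltW// ltrDl.
Qed.

Lemma lipschitz_const_scale c (a : R) f : 0 <= a -> lipschitz_const c f ->
  lipschitz_const (a * c) (fun t => (scalar_of_real a : scalar_field R k) *: f
    t).
Proof.
move=> a0 [c0 cf]; split; first by rewrite mulr_ge0.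
move=> s t; rewrite -scalerBr rnormZ rnorm_scalar_of_real ger0_norm//.
by rewrite -mulrA ler_wpM2l.
Qed.

Lemma lipschitz_const_vector c (h : T -> R) (x : X) : 0 <= c ->
  (forall s t, `|h s - h t| <= c * mdist s t) ->
  lipschitz_const (c * rnorm x)
    (fun t => (scalar_of_real (h t) : scalar_field R k) *: x).
Proof.
move=> c0 hc; split; first by rewrite mulr_ge0// rnorm_ge0.
move=> s t; rewrite -scalerBl -scalar_of_realB rnormZ rnorm_scalar_of_real.
by rewrite mulrAC ler_wpM2r ?rnorm_ge0.
Qed.

End Lipschitz.

(** The balls of a finite net of radius e/(c+1) are made disjoint, and f is replaced on each piece
    by its value at the centre. *)
Lemma lipschitz_totally_measurable (R : realType) (k : scalar_kind)
    (T : metricType R) (X : completeNormedModType (scalar_field R k))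
    (c : R) (f : T -> X) :
  compact [set: T] -> lipschitz_const c f -> totally_measurable f.
Proof.
move=> hT [c0 cf] e e0.
have r0 : 0 < e / (c + 1) by rewrite divr_gt0// ltr_wpDl.
have [l lP] := compact_finite_net hT r0.
(* The vanishing off the balls is carried through the induction: on the piece added by a new centre
   the earlier pairs must contribute 0. *)
suff [s [bs s1 _]] : exists s : seq (set T * X), [/\ borel_seq s,
    forall t, (exists2 a, a \in l & mdist a t < e / (c + 1)) ->
      rnorm (f t - simple_eval s t) <= e &
    forall t, ~ (exists2 a, a \in l & mdist a t < e / (c + 1)) ->
      simple_eval s t = 0].
  by exists s; split => // t; exact: s1.
elim: l {lP} => [|a l [s [bs s1 s2]]].
  by exists [::]; split => // [t []//|t _]; rewrite /simple_eval big_nil.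
pose U := \bigcup_(b in [set` l]) ball b (e / (c + 1)).
have UP t : U t <-> exists2 b, b \in l & mdist b t < e / (c + 1).
  by split => -[b bl]; [rewrite ballEmdist|]; exists b => //;
    rewrite ballEmdist.
exists ((ball a (e / (c + 1)) `\` U, f a) :: s); split.
- move=> p; rewrite inE => /orP[/eqP ->/=|/bs//]; apply: borelD.
    by apply: borel_open; exact: metric_ball_open.
  apply: borel_open; apply: bigcup_open => b _; exact: metric_ball_open.
- move=> t [b bl bt]; rewrite simple_eval_cons /= indicE.
  have [Ut|nUt] := pselect (U t).
    by rewrite memNset ?scale0r ?add0r; [exact/s1/UP|case].
  move: bl; rewrite inE => /orP[/eqP ba|bl]; last by exfalso; apply/nUt/UP;
    exists b.
  rewrite mem_set ?scale1r; last by split => //; rewrite ballEmdist /= -ba.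
  rewrite s2 ?addr0; last by move/UP.
  rewrite (le_trans (cf _ _))// metric_sym -ba.
  rewrite (@le_trans _ _ (c * (e / (c + 1))))//;
    first by rewrite ler_wpM2l// ltW.
  by rewrite mulrCA ger_pMr// ler_pdivrMr ?ltr_wpDl// mul1r lerDl.
- move=> t h; rewrite simple_eval_cons /= indicE memNset ?scale0r ?add0r.
    by apply: s2 => -[b bl bt]; apply: h; exists b => //; rewrite inE bl orbT.
  rewrite ballEmdist => -[at_ _]; apply: h; exists a => //; exact: mem_head.
Qed.

(** * Level counting, distance functions and their sublevel sets *)

Lemma sum_ltn_nat (m N : nat) : (\sum_(j < N) (j < m) = minn m N)%N.
Proof.
elim: N => [|N ih]; first by rewrite big_ord0 minn0.
rewrite big_ord_recr /= ih; case: (boolP (N < m)%N) => [Nm|].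
  by rewrite (minn_idPr (ltnW Nm)) (minn_idPr Nm) addn1.
by rewrite -leqNgt => mN; rewrite (minn_idPl mN) (minn_idPl (leqW mN)) addn0.
Qed.

(** A discrete layer-cake formula: one unit for each threshold 1, ..., N not above y, and none when
    y is negative. It turns a staircase function into a sum of indicators of level sets. *)
Lemma sum_level_indicators (R : realType) (N : nat) (y : R) : y <= N%:R ->
  \sum_(j < N) (j.+1%:R <= y)%R%:R = (Num.truncn y)%:R :> R.
Proof.
move=> yN; under eq_bigr do rewrite -truncn_gt_nat.
rewrite -natr_sum sum_ltn_nat; congr _%:R; apply/minn_idPl.
by rewrite -[N](@natrK R); exact: le_truncn.
Qed.

Section DistanceToSet.
Context (R : realType) (T : metricType R) (F : set T).
Hypothesis F0 : F !=set0.

Definition dist_to (t : T) : R := inf [set mdist t y | y in F].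

Let has_inf_dist t : has_inf [set mdist t y | y in F].
Proof.
split; first by have [y Fy] := F0; exists (mdist t y), y.
by exists 0 => _ [y _ <-]; exact: mdist_ge0.
Qed.

Lemma dist_to_ge0 t : 0 <= dist_to t.
Proof.
apply: lb_le_inf; first by have [] := has_inf_dist t.
by move=> _ [y _ <-]; exact: mdist_ge0.
Qed.

Lemma dist_to_lipschitz s t : `|dist_to s - dist_to t| <= mdist s t.
Proof.
have h u v : dist_to u - dist_to v <= mdist u v.
  rewrite lerBlDr -lerBlDl; apply: lb_le_inf;
    first by have [] := has_inf_dist v.
  move=> _ [y Fy <-]; rewrite lerBlDl.
  apply: le_trans (metric_triangle _ v _).
  by apply: ge_inf; [have [] := has_inf_dist u|exists y].
by rewrite ler_norml h andbT lerNl opprB metric_sym.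
Qed.

Lemma dist_to_le0 t : closed F -> dist_to t <= 0 <-> F t.
Proof.
move=> cF; split=> [t0|Ft]; last first.
  rewrite -(mdistxx t); apply: ge_inf; last by exists t.
  by have [] := has_inf_dist t.
rewrite ((closure_id F).1 cF) => B /nbhs_ballP[e /= e0 eB].
have [_ [y Fy <-]] := inf_adherent e0 (has_inf_dist t).
rewrite -/(dist_to t) => ye; exists y; split => //; apply: eB.
by rewrite ballEmdist /= (lt_le_trans ye)// gerDr.
Qed.

End DistanceToSet.

Lemma closed_sublevel (R : realType) (T : metricType R) (g : T -> R) (d : R) :
  (forall s t, `|g s - g t| <= mdist s t) -> closed [set t | g t <= d].
Proof.
move=> hg t h; apply/ler_addgt0Pl => e e0 /=.
have [s [sd]] := h _ (nbhsx_ballx t e e0).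
rewrite ballEmdist /= => /ltW ts.
rewrite -[g t](subrK (g s)) lerD//.
by rewrite (le_trans (ler_norm _))// (le_trans (hg _ _)).
Qed.

Section SublevelSets.
Context (R : realType) (k : scalar_kind) (T : metricType R)
  (X : normedModType (scalar_field R k)).
Variables (g : T -> R) (mu : cabv T X).
Hypothesis bg : forall d, borel [set t | g t <= d].

(** Right continuity at 0 of the measure of sublevel sets. Continuity from above concerns sequences,
    so a failure is turned into a sequence of bad levels decreasing to 0. *)
Lemma cabv_sublevel (e : R) : 0 < e -> exists2 d : R, 0 < d &
  forall r, 0 <= r <= d ->
    rnorm (mu [set t | g t <= r] - mu [set t | g t <= 0]) <= e.
Proof.
move=> e0; apply: contrapT => h.
(* The condition [0 < d] sits under the existential so that [choice] gives a total function. A bad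
   level cannot be 0, where the difference vanishes. *)
have bad (d : R) : exists r : R, 0 < d -> [/\ 0 < r, r <= d &
    e < rnorm (mu [set t | g t <= r] - mu [set t | g t <= 0])].
  have [d0|d0] := leP d 0; first by exists 0.
  apply: contrapT => nr; apply: h; exists d => // r /andP[r0 rd].
  rewrite leNgt; apply/negP => er; apply: nr; exists r => _; split => //.
  rewrite lt_def r0 andbT; apply/eqP => rE.
  by move: er; rewrite rE subrr rnorm0 ltNge ltW.
have {bad}[c cP] := choice bad.
have half_gt0 (x : R) : 0 < x -> 0 < x / 2 by move=> x0; rewrite divr_gt0.
(* Halving the allowed range each time makes u decreasing with limit 0, so its sublevel sets
   decrease to that of level 0. *)
pose u := fix u (n : nat) : R := if n is m.+1 then c (u m / 2) else c 1.
have u0 n : 0 < u n.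
  elim: n => [|n ih] /=; first by have [] := cP 1 ltr01.
  by have [] := cP (u n / 2) (half_gt0 _ ih).
have uS n : u n.+1 <= u n / 2 by have [] := cP (u n / 2) (half_gt0 _ (u0 n)).
have uB n : e < rnorm (mu [set t | g t <= u n] - mu [set t | g t <= 0]).
  case: n => [|n] /=; first by have [] := cP 1 ltr01.
  by have [] := cP (u n / 2) (half_gt0 _ (u0 n)).
have un n : u n <= 2^-1 ^+ n * u 0.
  elim: n => [|n ih]; first by rewrite expr0 mul1r.
  by rewrite (le_trans (uS n))// exprSr mulrAC ler_pM2r.
have capE : \bigcap_n [set t | g t <= u n] = [set t | g t <= 0].
  apply/seteqP; split => t /= gt0; last first.
    by move=> n _ /=; rewrite (le_trans gt0)// ltW.
  rewrite leNgt; apply/negP => gp.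
  have : (fun n => 2^-1 ^+ n * u 0%N) @ \oo --> 0 * u 0%N.
    apply: cvgMl; apply: cvg_expr; rewrite ger0_norm ?invr_ge0//.
    by rewrite invf_lt1// ltr1n.
  rewrite mul0r => /cvgr0Pnorm_lt/(_ _ gp)[N _ /(_ N (leqnn N))] /=.
  rewrite ltNge => /negP; apply; rewrite (le_trans (gt0 N I))//.
  by rewrite (le_trans (un N))// ler_norm.
have /cvgr_rnormP/(_ e e0)[N _ /(_ N (leqnn N))] : (fun n => mu [set t | g t <=
  u n]) @ \oo -->
    mu [set t | g t <= 0].
  rewrite -capE; apply: cabv_nonincreasing => //.
  apply/nonincreasing_seqP => n; apply/subsetPset => t /= gtu.
  rewrite (le_trans gtu)// (le_trans (uS n))// ler_pdivrMr//.
  by rewrite ler_pMr// ler1n.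
by rewrite rnormBC leNgt uB.
Qed.

End SublevelSets.

(** * Lipschitz functions determine measures *)

Section LipschitzDetermineMeasures.
Context (R : realType) (k : scalar_kind) (T : metricType R)
  (X : completeNormedModType (scalar_field R k))
  (dot : {dot X for @scalar_conj R k}).
Hypothesis hT : compact [set: T].
Hypothesis hdot : forall x : X, dot x x = `|x| ^+ 2.
Hypothesis hX : exists x : X, x <> 0.
Local Notation K := (scalar_field R k).
Implicit Types (mu nu : cabv T X) (x : X).

Definition tent (g : T -> R) (d : R) (t : T) : R := Num.max 0 (1 - g t / d).

Lemma tent_lipschitz g (d : R) : 0 < d ->
  (forall s t, `|g s - g t| <= mdist s t) ->
  forall s t, `|tent g d s - tent g d t| <= d^-1 * mdist s t.
Proof.
move=> d0 hg s t.
have max0B (a b : R) : `|Num.max 0 a - Num.max 0 b| <= `|a - b|.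
  have [a0|a0] := leP 0 a; have [b0|b0] := leP 0 b => //.
  - by rewrite subr0 (ger0_norm a0) (le_trans _ (ler_norm _))//; lra.
  - by rewrite distrC subr0 (ger0_norm b0) distrC (le_trans _ (ler_norm _))//;
    lra.
  - by rewrite subrr normr0.
rewrite (le_trans (max0B _ _))//.
have -> : 1 - g s / d - (1 - g t / d) = d^-1 * (g t - g s) by ring.
have di0 : 0 < d^-1 by rewrite invr_gt0.
by rewrite normrM gtr0_norm// ler_pM2l// distrC hg.
Qed.

(* The simple functions \sum_(j < N) 1_{(j+1)/N <= tent} x / N approximate
   tent * x uniformly, and their integrals only involve sublevel sets of g. *)
Lemma integral_tent mu (g : T -> R) (d e : R) x : 0 < d -> 0 <= e ->
  (forall s t, `|g s - g t| <= mdist s t) -> (forall t, 0 <= g t) ->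
  (forall r, 0 <= r <= d ->
    rnorm (mu [set t | g t <= r] - mu [set t | g t <= 0]) <= e) ->
  rnorm (Defs.integral dot mu (fun t => (scalar_of_real (tent g d t) : K) *: x)
    - dot x (mu [set t | g t <= 0])) <= rnorm x * e.
Proof.
move=> d0 e0 hg g0 ge; apply/ler_addgt0Pl => c c0.
have mtent : totally_measurable (fun t => (scalar_of_real (tent g d t) : K) *:
  x).
  apply: (lipschitz_totally_measurable hT).
  apply: lipschitz_const_vector (tent_lipschitz d0 hg).
  by rewrite invr_ge0 ltW.
have V0 := var_norm_ge0 mu.
(* A staircase with N steps errs by at most [rnorm x / N]; N is chosen so that this costs at most c
   in the integral. *)
have [N N0 Nc] : exists2 N : nat, (0 < N)%N & rnorm x / N%:R * var_norm mu <= c.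
  exists (Num.truncn (rnorm x * var_norm mu / c)).+1 => //.
  rewrite mulrAC ler_pdivrMr ?ltr0n// (mulrC c) -ler_pdivrMr// ltW//.
  exact: truncnS_gt.
have NR0 : 0 < N%:R :> R by rewrite ltr0n.
(* The level of g at which 1 - g/d equals (j+1)/N. For j < N it lies between 0 and d, where the
   hypothesis [ge] applies. *)
pose lev (j : nat) : R := d * (1 - j.+1%:R / N%:R).
pose s : seq (set T * X) :=
  [seq ([set t | g t <= lev (val j)], (scalar_of_real N%:R^-1 : K) *: x)
     | j <- index_enum 'I_N].
have bs : borel_seq s.
  by move=> p /mapP[j _ ->] /=; apply: borel_closed; exact: closed_sublevel.
have levP j t : (g t <= lev j) = (j.+1%:R <= N%:R * (1 - g t / d)).
  rewrite /lev -ler_pdivrMl// mulrC.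
  rewrite -[RHS]ler_pdivrMl// (mulrC N%:R^-1).
  by rewrite lerBrDl [RHS]lerBrDl [in RHS]addrC.
have sE t : simple_eval s t =
    (scalar_of_real ((Num.truncn (N%:R * (1 - g t / d)))%:R / N%:R) : K) *: x.
  rewrite /simple_eval big_map -(sum_level_indicators (N := N)); last first.
    by rewrite ger_pMr// gerBl divr_ge0// ltW.
  rewrite mulr_suml.
  rewrite (big_morph _ (@scalar_of_realD R k) (@scalar_of_real0 R k))
    scaler_suml.
  apply: eq_bigr => j _; rewrite scalar_of_realM -scalerA; congr (_ *: _).
  rewrite /= indicE -levP; case: (boolP (g t <= lev j)) => gl.
    by rewrite mem_set// scalar_of_real1.
  by rewrite memNset ?scalar_of_real0//= => h; rewrite h in gl.
have sa : approximates (rnorm x / N%:R) (fun t => (scalar_of_real (tent g d t)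
  : K) *: x) s.
  split => // t; rewrite sE -scalerBl -scalar_of_realB rnormZ
    rnorm_scalar_of_real.
  rewrite mulrC ler_wpM2l ?rnorm_ge0// /tent.
  set y := N%:R * (1 - g t / d).
  have yE : 1 - g t / d = y / N%:R by rewrite /y mulrAC divff ?mul1r// gt_eqF.
  rewrite yE.
  (* For negative y both the tent and the truncation are 0; otherwise rounding y down changes it by
     at most 1, hence by at most 1/N after division. *)
  have [y0|y0] := leP 0 (y / N%:R); last first.
    have y1 : y < 1 by move: y0; rewrite ltr_pdivrMr// mul0r => /lt_trans;
      exact.
    have -> : Num.truncn y = 0%N by apply/truncn0Pn; rewrite -ltNge.
    by rewrite mul0r subrr normr0 invr_ge0 ltW.
  have {}y0 : 0 <= y by move: y0; rewrite ler_pdivlMr// mul0r.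
  have /andP[ty yt] := truncn_itv y0.
  rewrite -mulrBl normrM (gtr0_norm (x := N%:R^-1)) ?invr_gt0//.
  rewrite ger_pMl ?invr_gt0// ger0_norm ?subr_ge0//.
  by rewrite lerBlDl natr1 ltW.
have h1 := integral_approx hdot hX mu mtent _ sa.
rewrite (le_trans (rnorm_distD (simple_integral dot mu s) _ _))// lerD//.
  by rewrite (le_trans (h1 _))// divr_ge0 ?rnorm_ge0// ltW.
(* The target is cut into N equal shares, to be compared with the N levels term by term. *)
have -> : dot x (mu [set t | g t <= 0]) = \sum_(j < N)
    dot ((scalar_of_real N%:R^-1 : K) *: x) (mu [set t | g t <= 0]).
  rewrite sumr_const card_ord dotZl -[RHS]mulr_natl mulrA.
  have -> : N%:R = scalar_of_real N%:R :> K.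
    elim: (N) => [|n ih]; first by rewrite scalar_of_real0.
    by rewrite -!natr1 scalar_of_realD ih scalar_of_real1.
  by rewrite -scalar_of_realM divff ?gt_eqF// scalar_of_real1 mul1r.
rewrite /simple_integral big_map -sumrB (le_trans (rnorm_sum _ _ _))//.
apply: (@le_trans _ _ (\sum_(j < N) (N%:R^-1 * (rnorm x * e)))).
  apply: ler_sum => j _; rewrite -dotBr (le_trans (cauchy_schwarz hdot _ _))//.
  rewrite rnormZ rnorm_scalar_of_real ger0_norm ?invr_ge0// -mulrA.
  rewrite ler_wpM2l ?invr_ge0// ler_wpM2l ?rnorm_ge0// ge//.
  have jN : j.+1%:R / N%:R <= 1 :> R by rewrite ler_pdivrMr// mul1r ler_nat.
  rewrite mulr_ge0 ?(ltW d0) ?subr_ge0//= ger_pMr// gerBl divr_ge0//.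
by rewrite sumr_const card_ord -[leLHS]mulr_natl mulrA divff ?mul1r// gt_eqF.
Qed.

(** The tents over F are taken in the direction [mu F] itself: their integrals are 0 and approximate
    the square of the norm of [mu F]. *)
Lemma lipschitz_integral_closed0 mu F :
  (forall c f, lipschitz_const c f -> Defs.integral dot mu f = 0) ->
  closed F -> mu F = 0.
Proof.
move=> mu0 cF; have [->|/set0P F0] := eqVneq F set0; first exact: cabv_set0.
have FE : [set t | dist_to F t <= 0] = F.
  by apply/seteqP; split => t /=; apply dist_to_le0.
have hg := dist_to_lipschitz F0.
suff d0 : dot (mu F) (mu F) = 0.
  by apply/eqP; rewrite -normr_eq0 -sqrf_eq0 -hdot d0.
apply: (@rnorm_small_eq0 _ _ _ (rnorm (mu F))) => e e0.
have [d d0 dP] := cabv_sublevel (g := dist_to F) mu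
  (fun r => borel_closed (closed_sublevel (d := r) hg)) e0.
have := integral_tent (mu F) d0 (ltW e0) hg (dist_to_ge0 F0) dP.
rewrite FE (mu0 _ _ (lipschitz_const_vector (mu F) _ (tent_lipschitz d0 hg))).
  by rewrite sub0r rnormN.
by rewrite invr_ge0 ltW.
Qed.

Lemma lipschitz_integral_eq0 mu :
  (forall c f, lipschitz_const c f -> Defs.integral dot mu f = 0) -> mu = 0.
Proof.
move=> mu0; have muT : mu setT = 0.
  by apply: lipschitz_integral_closed0 => //; exact: closedT.
apply: cabv_eqP => A bA; rewrite cabv0E.
suff : @borel T `<=` [set B | borel B /\ mu B = 0] by move=> /(_ A bA)[].
(* Open sets form the generating pi-system. They inherit measure 0 from closed sets through
   complements, since the total mass is 0. *)
apply: lambda_system_subset => //.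
- by move=> B C; exact: openI.
- split => //.
  + by split; [exact: borelT|].
  + move=> B C CB [bB B0] [bC C0]; split; first exact: borelD.
    have := cabv_split mu bB bC.
    by rewrite (setIidr CB) B0 C0 add0r => <-.
  + move=> G ndG hG; have bG n : borel (G n) by have [] := hG n.
    split; first exact: borel_bigcup.
    have := cabv_nondecreasing (mu := mu) bG ndG.
    under eq_fun do rewrite (hG _).2.
    by move=> /cvg_unique; apply => //; exact: cvg_cst.
- move=> U oU; split; first exact: borel_open.
  rewrite -(setCK U) cabvC ?muT ?sub0r; last exact: borelC (borel_open oU).
  by rewrite lipschitz_integral_closed0 ?oppr0//; exact: open_closedC.
Qed.

End LipschitzDetermineMeasures.

(** * The norms *)

Section MongeKantorovichNorm.
Context (R : realType) (k : scalar_kind) (T : metricType R)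
  (X : completeNormedModType (scalar_field R k))
  (dot : {dot X for @scalar_conj R k}).
Hypothesis hT : compact [set: T].
Hypothesis hT0 : inhabited T.
Hypothesis hdot : forall x : X, dot x x = `|x| ^+ 2.
Hypothesis hX : exists x : X, x <> 0.
Local Notation K := (scalar_field R k).
Implicit Types (mu nu : cabv T X) (f : T -> X) (a : K).

Lemma rnorm_integral_lipschitz mu c f : cabv0 mu -> lipschitz_const c f ->
  rnorm (Defs.integral dot mu f) <= c * diam T * var_norm mu.
Proof.
move=> mu0 cf; have [t0] := hT0; have [c0 fc] := cf.
have mf := lipschitz_totally_measurable hT cf.
have mcst := totally_measurable_cst T (- f t0).
have := integral_comb hdot hX mu 1 mf mcst.
rewrite integral_constant// mu0 dot0r addr0 mul1r => <-.
apply: integral_bound => //; first exact: totally_measurable_comb.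
  by rewrite mulr_ge0// diam_ge0.
move=> t; rewrite scale1r (le_trans (fc _ _))// ler_wpM2l//.
exact: mdist_le_diam.
Qed.

(** Makes the real [sup] in [MK_norm] a genuine supremum; total mass 0 is what bounds the integrals
    over all of [L1]. *)
Lemma MK_has_sup mu : cabv0 mu ->
  has_sup [set rnorm (Defs.integral dot mu f) | f in @L1 R k T X].
Proof.
move=> mu0; split.
  exists (rnorm (Defs.integral dot mu (fun=> 0))), (fun=> 0) => //.
  apply/L1P; split => // s t; rewrite subrr rnorm0 mul1r; exact: mdist_ge0.
exists (diam T * var_norm mu) => _ [f /L1P fL <-].
by rewrite -[diam T]mul1r rnorm_integral_lipschitz.
Qed.

Lemma rnorm_integral_le_MK mu f : cabv0 mu -> lipschitz_const 1 f ->
  rnorm (Defs.integral dot mu f) <= MK_norm dot mu.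
Proof.
move=> mu0 f1; apply: sup_upper_bound; first exact: MK_has_sup.
by exists f => //; apply/L1P.
Qed.

Lemma MK_norm_le mu M : cabv0 mu ->
  (forall f, lipschitz_const 1 f -> rnorm (Defs.integral dot mu f) <= M) ->
  MK_norm dot mu <= M.
Proof.
move=> mu0 h; apply: ge_sup; first by have [] := MK_has_sup mu0.
by move=> _ [f /L1P fL <-]; exact: h.
Qed.

Lemma MK_norm_ge0 mu : cabv0 mu -> 0 <= MK_norm dot mu.
Proof.
move=> mu0; apply: le_trans (rnorm_integral_le_MK (f := fun=> 0) mu0 _).
  exact: rnorm_ge0.
by split => // s t; rewrite subrr rnorm0 mul1r; exact: mdist_ge0.
Qed.

Lemma cabv0_mass mu : cabv_val mu setT = 0 -> cabv0 mu.
Proof. by []. Qed.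

Lemma cabv0_comb a mu nu : cabv0 mu -> cabv0 nu -> cabv0 (a *: mu + nu).
Proof.
by move=> mu0 nu0; apply: cabv0_mass;
  rewrite cabvDE cabvZE mu0 nu0 scaler0 addr0.
Qed.

(** The integral is conjugate-linear in the measure, and conjugation preserves the modulus of a. *)
Lemma MK_norm_comb a mu nu : cabv0 mu -> cabv0 nu ->
  MK_norm dot (a *: mu + nu) <= rnorm a * MK_norm dot mu + MK_norm dot nu.
Proof.
move=> mu0 nu0; apply: MK_norm_le => [|f f1]; first exact: cabv0_comb.
rewrite integral_measure_comb//; last exact: lipschitz_totally_measurable f1.
rewrite (le_trans (rnormD _ _))// rnormM rnorm_conj.
by rewrite lerD ?ler_wpM2l ?rnorm_ge0// rnorm_integral_le_MK.
Qed.

Lemma MK_norm_le_var mu : cabv0 mu -> MK_norm dot mu <= diam T * var_norm mu.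
Proof.
move=> mu0; apply: MK_norm_le => // f f1.
by rewrite -[diam T]mul1r rnorm_integral_lipschitz.
Qed.

Lemma cabv0_0 : cabv0 (0 : cabv T X).
Proof. by []. Qed.

Lemma MK_norm0 : MK_norm dot (0 : cabv T X) = 0.
Proof.
apply/le_anti; rewrite MK_norm_ge0 ?andbT; last exact: cabv0_0.
by rewrite (le_trans (MK_norm_le_var cabv0_0))// var_norm0 mulr0.
Qed.

Lemma MK_norm_eq0 mu : cabv0 mu -> MK_norm dot mu = 0 -> mu = 0.
Proof.
move=> mu0 MK0; apply: (lipschitz_integral_eq0 hT hdot hX) => c f cf.
have [c0 fc] := cf; have c1 : 0 < c + 1 by rewrite ltr_wpDl.
(* Rescaling brings f into the unit Lipschitz ball; c + 1 replaces c because c may be 0. *)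
pose g t := (scalar_of_real (c + 1)^-1 : K) *: f t.
have g1 : lipschitz_const 1 g.
  rewrite -(@mulVf _ (c + 1)) ?gt_eqF//.
  apply: lipschitz_const_scale; first by rewrite invr_ge0 ltW.
  split; first exact: ltW.
  by move=> s t; rewrite (le_trans (fc s t))// ler_wpM2r ?mdist_ge0// lerDl.
have Ig : Defs.integral dot mu g = 0.
  apply: rnorm_eq0; apply/le_anti; rewrite rnorm_ge0 andbT -MK0.
  exact: rnorm_integral_le_MK.
have mg := lipschitz_totally_measurable hT g1.
have := integral_comb hdot hX mu (scalar_of_real (c + 1)) mg
  (totally_measurable_cst T 0).
rewrite Ig mulr0 integral_constant// dot0l addr0 => <-;
  congr (Defs.integral _ _ _).
apply/funext => t; rewrite /g scalerA -scalar_of_realM divff ?gt_eqF//.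
by rewrite scalar_of_real1 scale1r addr0.
Qed.

Lemma H_norm_le mu nu : cabv0 nu ->
  H_norm dot mu <= MK_norm dot nu + var_norm (mu - nu).
Proof.
move=> nu0; apply: ge_inf; last by exists nu.
by exists 0 => _ [m m0 <-]; rewrite addr_ge0 ?var_norm_ge0 ?MK_norm_ge0.
Qed.

Lemma H_norm_ge mu M :
  (forall nu, cabv0 nu -> M <= MK_norm dot nu + var_norm (mu - nu)) ->
  M <= H_norm dot mu.
Proof.
move=> h; apply: lb_le_inf; last by move=> _ [nu nu0 <-]; exact: h.
by exists (MK_norm dot (0 : cabv T X) + var_norm (mu - 0)), (0 : cabv T X).
Qed.

Lemma H_norm_ge0 mu : 0 <= H_norm dot mu.
Proof.
by apply: H_norm_ge => nu nu0; rewrite addr_ge0 ?var_norm_ge0 ?MK_norm_ge0.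
Qed.

(** The competitor 0 in the infimum; the next bound uses the competitor mu. *)
Lemma H_norm_le_var mu : H_norm dot mu <= var_norm mu.
Proof. by have := H_norm_le mu cabv0_0; rewrite MK_norm0 add0r subr0. Qed.

Lemma H_norm_le_MK mu : cabv0 mu -> H_norm dot mu <= MK_norm dot mu.
Proof. by move=> mu0; have := H_norm_le mu mu0;
  rewrite subrr var_norm0 addr0. Qed.

Lemma MK_norm_le_H mu : cabv0 mu ->
  MK_norm dot mu <= Num.max (diam T) 1 * H_norm dot mu.
Proof.
move=> mu0; set D := Num.max _ _.
have D1 : 1 <= D by rewrite le_max lexx orbT.
have D0 : 0 < D by exact: lt_le_trans D1.
(* After division by D the claim is a lower bound for the infimum, checked for each nu. D dominates
   both the weight 1 of the [MK_norm] term and the weight [diam T] of the variation term. *)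
rewrite mulrC -ler_pdivrMr//; apply: H_norm_ge => nu nu0.
rewrite ler_pdivrMr// mulrDl.
have munu0 : cabv0 (mu - nu) by apply: cabv0_mass; rewrite cabvBE mu0 nu0 subrr.
have -> : mu = 1 *: nu + (mu - nu) by rewrite scale1r addrC subrK.
rewrite (le_trans (MK_norm_comb _ nu0 munu0))//.
rewrite -(@scalar_of_real1 R k) rnorm_scalar_of_real normr1 mul1r.
rewrite scalar_of_real1 scale1r addrAC subrr add0r.
rewrite lerD//; first by rewrite ler_peMr// MK_norm_ge0.
rewrite (le_trans (MK_norm_le_var munu0))// mulrC ler_wpM2l ?var_norm_ge0//.
by rewrite le_max lexx.
Qed.

(** A competitor nu for mu gives the competitor [a *: nu] for [a *: mu]; a = 0 is set apart because
    of the division by [rnorm a]. *)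
Lemma H_normZ_le a mu : H_norm dot (a *: mu) <= rnorm a * H_norm dot mu.
Proof.
have [->|a0] := eqVneq a 0.
  by rewrite scale0r rnorm0 mul0r (le_trans (H_norm_le_var _))// var_norm0.
have ra0 : 0 < rnorm a.
  by rewrite lt_def rnorm_ge0 andbT; apply: contra_neq a0; exact: rnorm_eq0.
rewrite mulrC -ler_pdivrMr//; apply: H_norm_ge => nu nu0.
have anu0 : cabv0 (a *: nu) by apply: cabv0_mass; rewrite cabvZE nu0 scaler0.
rewrite ler_pdivrMr// mulrC mulrDr (le_trans (H_norm_le _ anu0))// lerD//.
  rewrite -[a *: nu]addr0 (le_trans (MK_norm_comb _ nu0 cabv0_0))//.
  by rewrite MK_norm0 addr0.
by rewrite -scalerBr var_normZ.
Qed.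

(** Competitors for mu and nu add up to one for the sum; the two infima are taken one after the
    other. *)
Lemma H_normD mu nu :
  H_norm dot (mu + nu) <= H_norm dot mu + H_norm dot nu.
Proof.
rewrite -lerBlDr; apply: H_norm_ge => mu' mu'0.
rewrite lerBlDr -lerBlDl; apply: H_norm_ge => nu' nu'0.
rewrite lerBlDl; have s0 : cabv0 (mu' + nu').
  by apply: cabv0_mass; rewrite cabvDE mu'0 nu'0 addr0.
rewrite [leRHS](_ : _ = MK_norm dot mu' + MK_norm dot nu' +
  (var_norm (mu - mu') + var_norm (nu - nu'))); last by ring.
rewrite (le_trans (H_norm_le _ s0))// opprD addrACA lerD ?var_normD//.
rewrite -[mu' in leLHS]scale1r (le_trans (MK_norm_comb _ mu'0 nu'0))//.
by rewrite -(@scalar_of_real1 R k) rnorm_scalar_of_real normr1 mul1r.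
Qed.

(* The total mass is continuous for H_norm, since it kills cabv0. *)
Lemma rnorm_setT_le_H mu : rnorm (mu setT) <= H_norm dot mu.
Proof.
apply: H_norm_ge => nu nu0.
have -> : mu setT = cabv_val (mu - nu) setT by rewrite cabvBE nu0 subr0.
by rewrite (le_trans (rnorm_setT_le_var_norm _))// lerDr MK_norm_ge0.
Qed.

Lemma H_norm_eq0 mu : H_norm dot mu = 0 -> mu = 0.
Proof.
move=> H0; have mu0 : cabv0 mu.
  by apply: rnorm_eq0; apply/le_anti;
    rewrite rnorm_ge0 andbT -H0 rnorm_setT_le_H.
apply: MK_norm_eq0 => //; apply/le_anti; rewrite MK_norm_ge0// andbT.
by rewrite (le_trans (MK_norm_le_H mu0))// H0 mulr0.
Qed.

Lemma H_norm_is_norm : is_norm (H_norm dot : cabv T X -> R).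
Proof.
split; [exact: H_norm_ge0|exact: H_norm_eq0| |exact: H_normD] => a mu.
apply/le_anti; rewrite H_normZ_le /=.
have [->|a0] := eqVneq a 0; first by rewrite rnorm0 mul0r H_norm_ge0.
(* The reverse inequality of homogeneity comes from scaling back by the inverse of a. *)
have := H_normZ_le a^-1 (a *: mu).
rewrite scalerA mulVf// scale1r rnormV mulrC ler_pdivlMr;
  first by rewrite mulrC.
by rewrite lt_def rnorm_ge0 andbT; apply: contra_neq a0; exact: rnorm_eq0.
Qed.

End MongeKantorovichNorm.

Theorem theorem23 (R : realType) (k : scalar_kind) (T : metricType R)
    (X : completeNormedModType (scalar_field R k))
    (dot : {dot X for @scalar_conj R k})
    (hT : compact [set: T]) (hT2 : exists x y : T, x <> y)
    (hdot : forall x : X, dot x x = `|x| ^+ 2)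
    (hX : exists x : X, x <> 0) :
  [/\ is_norm (H_norm dot : cabv T X -> R),
      weaker_topology (H_norm dot : cabv T X -> R) var_norm &
      forall mu : cabv T X, H_norm dot mu <= var_norm mu]
  /\
  [/\ equivalent_on cabv0 (H_norm dot : cabv T X -> R) (MK_norm dot),
      forall mu : cabv T X, cabv0 mu ->
        H_norm dot mu <= MK_norm dot mu <= Num.max (diam T) 1 * H_norm dot mu &
      diam T <= 1 ->
        forall mu : cabv T X, cabv0 mu -> H_norm dot mu = MK_norm dot mu].
Proof.
have hT0 : inhabited T by have [x _] := hT2.
have HMK (mu : cabv T X) : cabv0 mu ->
    H_norm dot mu <= MK_norm dot mu <= Num.max (diam T) 1 * H_norm dot mu.
  by move=> mu0; rewrite H_norm_le_MK//= MK_norm_le_H.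
split; split => //.
- exact: H_norm_is_norm.
(* A variational ball lies inside the [H_norm] ball of the same radius. *)
- move=> U oU mu /oU[r r0 rU]; exists r => // nu nur.
  by apply: rU; apply: le_lt_trans nur; exact: H_norm_le_var.
- by move=> mu; exact: H_norm_le_var.
- exists 1, (Num.max (diam T) 1); split => //;
  first by rewrite lt_max ltr01 orbT.
  by move=> mu /HMK; rewrite mul1r.
- move=> T1 mu /HMK /andP[le1 le2]; apply/le_anti; rewrite le1 /=.
  by rewrite (max_idPr T1) mul1r in le2.
Qed.
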